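(* Let $d\ge3$ and suppose $C\in\mathcal{C}^d_{\rm c}$ satisfies $d_\infty(C,\psi(C))\ne0$. Then $C$ is a discontinuity point of the mapping $\psi:\mathcal{C}^d_{\rm c}\to\mathcal{C}^d_{\rm c}$ (with respect to $d_\infty$) assigning to every copula its partial vine copula of D-vine structure.
   Context: $\mathbb{I}=[0,1]$, $\lambda$ Lebesgue measure, $d_\infty$ the uniform distance between $d$-dimensional copulas. For a $d$-dimensional copula $C$ and $J\subseteq\{1,\dots,d\}$, $C_J$ is the marginal copula of the coordinates in $J$ and $\mu_{C_J}$ its measure. For $J$ with $|J|\ge2$ and $\emptyset\ne L\subseteq J$ with $|L|\le|J|-2$, $F_{j|L}(\cdot|\mathbf{t})$ ($j\in J\setminus L$) denote the univariate conditional distribution functions of coordinate $j$ given the coordinates in $L$ equal $\mathbf{t}$ (from a regular conditional distribution under $C_J$), and $C^{\mathbf{t}}_{J\setminus L;L}$ the copula of the conditional distribution of the coordinates $J\setminus L$ given $\mathbf{t}$. $\mathcal{C}^d_{\rm c}$ is the family of $d$-dimensional copulas for which all these conditional univariate distribution functions are continuous for $\mu_{C_L}$-a.e. $\mathbf{t}$. For $C\in\mathcal{C}^d_{\rm c}$ define $C^{\rm PVC}$ recursively: $(C^{\rm PVC})_{i,i+1}:=C_{i,i+1}$, $i=1,\dots,d-1$. For $k=2,\dots,d-1$, $i=1,\dots,d-k$, $M=\{i+1,\dots,i+k-1\}$: $(C_p)_{i,i+k}(a,b):=\int_{\mathbb{I}^{k-1}}C^{\mathbf{w}}_{\{i,i+k\};M}(a,b)\,d\mu_{(C^{\rm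 PVC})_M}(\mathbf{w})$ (for $k=2$ this measure is $\lambda$), and $(C^{\rm PVC})_{i,\dots,i+k}(u_i,\dots,u_{i+k}):=\int_{\times_{m\in M}[0,u_m]}(C_p)_{i,i+k}(F^{\rm PVC}_{i|M}(u_i|\mathbf{t}),F^{\rm PVC}_{i+k|M}(u_{i+k}|\mathbf{t}))\,d\mu_{(C^{\rm PVC})_M}(\mathbf{t})$, where $F^{\rm PVC}_{i|M}$, $F^{\rm PVC}_{i+k|M}$ are the conditional univariate distribution functions derived from the previously constructed $(C^{\rm PVC})_{i,\dots,i+k-1}$ resp. $(C^{\rm PVC})_{i+1,\dots,i+k}$. Then $\psi(C):=(C^{\rm PVC})_{1,\dots,d}$. *)

(* Defs.v *)
From HB Require Import structures.
From mathcomp Require Import all_boot all_order all_algebra.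
From mathcomp Require Import all_classical all_reals all_analysis measurable_realfun.
From Stdlib Require Import ClassicalEpsilon.

Set Implicit Arguments.
Unset Strict Implicit.
Unset Printing Implicit Defensive.

Import Order.TTheory GRing.Theory Num.Theory.
Import numFieldNormedType.Exports.
Local Open Scope classical_set_scope.
Local Open Scope ring_scope.

(* Points of R^d are d-tuples of reals (product sigma-algebra from
   measure_tuple_display).  Coordinates are numbered 0..d-1 (paper: 1..d).
   All measures live on the full space R^d; the marginal on a set of
   coordinates J is read off by looking only at the coordinates in J. *)

Section copula_defs.
Variables (R : realType) (d : nat).

Definition pt := (d.-tuple R).

Definition coord (x : pt) (p : nat) : R := nth 0 x p.

Definition cube : set pt := [set x | forall p, (p < d)%N -> 0 <= coord x p <= 1].

Definition orth (S : nat -> Prop) (u : pt) : set pt :=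
  [set x | forall p, (p < d)%N -> S p -> coord x p <= coord u p].

Definition blk (i k : nat) : nat -> Prop := fun p => (i <= p)%N /\ (p <= i + k)%N.

Definition all_coords : nat -> Prop := fun _ => True.

Definition is_copula_measure (mu : probability pt R) : Prop :=
  mu cube = 1%E /\
  forall p, (p < d)%N -> forall a : R, 0 <= a <= 1 ->
    mu [set x | coord x p <= a] = a%:E.

Definition represents (mu : probability pt R) (C : pt -> R) : Prop :=
  is_copula_measure mu /\
  forall u, cube u -> (C u)%:E = mu (orth all_coords u).

Definition is_copula (C : pt -> R) : Prop := exists mu, represents mu C.

(* sets in the sigma-algebra generated by the coordinates in L *)
Definition L_measurable (L : nat -> Prop) (A : set pt) : Prop :=
  measurable A /\
  forall x y, (forall p, L p -> coord x p = coord y p) -> A x -> A y.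

Definition rcd (mu : probability pt R) (L : nat -> Prop)
    (kappa : pt -> probability pt R) : Prop :=
  (forall x y, (forall p, L p -> coord x p = coord y p) ->
     forall E, kappa x E = kappa y E) /\
  (forall E, measurable E -> measurable_fun [set: pt] ((fun x => kappa x E) : pt -> \bar R)) /\
  (forall A E, L_measurable L A -> measurable E ->
     mu (A `&` E) = (\int[mu]_(x in A) kappa x E)%E).

Definition cdf1 (kappa : pt -> probability pt R) (p : nat) (x : pt) (a : R) : R :=
  fine (kappa x [set z | coord z p <= a]).

(* copula of the bivariate conditional distribution of (X_p, X_q) given x:
   the joint distribution function of the probability integral transforms
   (F_{p|L}(X_p|x), F_{q|L}(X_q|x)) under kappa(x) *)
Definition condcop (kappa : pt -> probability pt R) (p q : nat) (x : pt)
    (a b : R) : R :=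
  fine (kappa x [set z | cdf1 kappa p x (coord z p) <= a /\
                         cdf1 kappa q x (coord z q) <= b]).

Definition Cpart (kappa : pt -> probability pt R) (nuM : probability pt R)
    (p q : nat) (a b : R) : R :=
  fine (\int[nuM]_w (condcop kappa p q w a b)%:E)%E.

Definition in_Cc (C : pt -> R) : Prop :=
  exists mu, represents mu C /\
  forall (L : {set 'I_d}) (j : 'I_d),
    (0 < #|L|)%N -> (#|L| <= d - 2)%N -> j \notin L ->
    forall kappa, rcd mu (fun p => exists2 l : 'I_d, l \in L & val l = p) kappa ->
    {ae mu, forall x, continuous (fun a : R => cdf1 kappa (val j) x a)}.

(* nu i k is a measure whose marginal on the block {i..i+k} is
   (C^PVC)_{i,...,i+k}; the defining recursion of the D-vine PVC. *)
Definition PVC_family (mu : probability pt R)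
    (nu : nat -> nat -> probability pt R) : Prop :=
  forall i k, (i + k < d)%N ->
  match k with
  | 0 => forall a : R, 0 <= a <= 1 ->
           nu i 0%N [set x | coord x i <= a] = a%:E
  | 1 => forall u, cube u -> nu i 1%N (orth (blk i 1) u) = mu (orth (blk i 1) u)
  | k'.+2 =>
      (* M = {i+1, ..., i+k-1} = blk (i+1) k' ; (C^PVC)_M is nu (i+1) k' *)
      exists kappa1 kappa2 kappa3,
        rcd (nu i k'.+1) (blk i.+1 k') kappa1 /\
        rcd (nu i.+1 k'.+1) (blk i.+1 k') kappa2 /\
        rcd mu (blk i.+1 k') kappa3 /\
        forall u, cube u ->
          nu i k (orth (blk i k) u) =
          (\int[nu i.+1 k']_(x in orth (blk i.+1 k') u)
             (Cpart kappa3 (nu i.+1 k') i (i + k)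
                (cdf1 kappa1 i x (coord u i))
                (cdf1 kappa2 (i + k) x (coord u (i + k))))%:E)%E
  end.

Definition is_PVC (C P : pt -> R) : Prop :=
  exists mu nu, represents mu C /\ PVC_family mu nu /\
    forall u, cube u -> (P u)%:E = nu 0%N d.-1 (orth (blk 0 d.-1) u).

Definition psi (C : pt -> R) : pt -> R :=
  epsilon (inhabits C) (fun P => is_PVC C P).

Definition dinf (C D : pt -> R) : R :=
  sup [set `|C u - D u| | u in cube].

End copula_defs.

(* Main.v *)
(* The copulas C' that are their own partial vine copula are dense.  Cut the
   cube into (n+1)^d cells, give the cell s its mass w s under C, and replace C
   inside s by the uniform law on a product of intervals of length w s.  For
   each coordinate these intervals are chosen pairwise disjoint and inside the
   corresponding cell, so they tile [0,1] and C' is a copula within d/(n+1) of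
   C.  Any single coordinate of a C'-random point then reveals s, and given s
   the coordinates are independent and uniform.  Hence all conditional
   distribution functions of C' are continuous, all its conditional copulas
   given a nonempty set of coordinates are independence copulas, and the
   recursion gives psi C' = C'.  If psi were continuous at C, then
   psi C' = C' -> C would force psi C = C. *)

Require Import Defs.
From HB Require Import structures.
From mathcomp Require Import all_boot all_order all_algebra.
From mathcomp Require Import all_classical all_reals all_analysis measurable_realfun.
From mathcomp Require Import zify.
From Stdlib Require Import ClassicalEpsilon.
(* Both [vector] and [Defs] define [coord]: the last import wins. *)
Import Defs.

Set Implicit Arguments.
Unset Strict Implicit.
Unset Printing Implicit Defensive.

Import Order.TTheory GRing.Theory Num.Theory.
Import numFieldNormedType.Exports.
Local Open Scope ring_scope.
Local Open Scope classical_set_scope.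

(** Conditional laws are determined only almost everywhere, and [psi] selects an arbitrary solution
    of the recursion. So two facts are needed: the law Q of C' is a solution, and every solution,
    for any choice of kernels, has the block marginals of Q. The integrands come from arbitrary
    kernels with no measurability given, hence they are compared with step functions off a null set.
    Spreading the mass of a cell uniformly over the whole cell would not do: cells with the same
    index in a coordinate would stay mixed after conditioning on it. The length w s is forced by the
    marginals: component s has weight w s and density 1/(w s) in each coordinate, so it projects to
    Lebesgue measure on its interval. The bound d/(n+1) counts the cells cut by the boundary of
    [0,u]: d layers, each of mass 1/(n+1). *)

Section coordinates.

(** * Coordinates, boxes and rational orthants *)

Context (R : realType) (d : nat).
Implicit Types (J L : nat -> Prop) (x y z u : pt R d) (A B E : set (pt R d)).

Lemma coord_tnth x (p : 'I_d) : coord x p = tnth x p.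
Proof. by rewrite /coord (tnth_nth 0). Qed.

Lemma coord_out x p : (d <= p)%N -> coord x p = 0.
Proof. by move=> dp; rewrite /coord nth_default ?size_tuple. Qed.

Lemma coord_mktuple (f : nat -> R) p :
  (p < d)%N -> coord [tuple f i | i < d] p = f p.
Proof. by move=> pd; rewrite (coord_tnth _ (Ordinal pd)) tnth_mktuple. Qed.

Lemma eq_coord x y : (forall p, (p < d)%N -> coord x p = coord y p) -> x = y.
Proof. by move=> xy; apply/eq_from_tnth => i; rewrite -!coord_tnth; exact: xy. Qed.

Lemma measurable_coord p : measurable_fun setT (fun x : pt R d => coord x p).
Proof.
have [dp|pd] := leqP d p.
  rewrite (_ : (fun _ => _) = cst 0) //.
  by apply/funext => x; rewrite coord_out.
rewrite (_ : (fun _ => _) = (fun x => tnth (x : d.-tuple R) (Ordinal pd))).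
  exact: measurable_tnth.
by apply/funext => x; rewrite -coord_tnth.
Qed.

Lemma measurable_mkcoord dT (T : measurableType dT) (f : nat -> T -> R) :
  (forall p, (p < d)%N -> measurable_fun setT (f p)) ->
  measurable_fun setT (fun t => [tuple f i t | i < d] : pt R d).
Proof.
move=> mf; apply/measurable_fun_tnthP => i.
rewrite (_ : _ \o _ = f i); first exact: mf.
by apply/funext => t /=; rewrite tnth_mktuple.
Qed.

Lemma measurable_coord_in p (B : set R) :
  measurable B -> measurable [set x : pt R d | B (coord x p)].
Proof. by move=> mB; rewrite -[X in measurable X]setTI; exact: measurable_coord. Qed.

Definition cbox (B : nat -> set R) : set (pt R d) :=
  [set x | forall p, (p < d)%N -> B p (coord x p)].

Lemma measurable_box (B : nat -> set R) :
  (forall p, (p < d)%N -> measurable (B p)) -> measurable (cbox B).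
Proof.
move=> mB; rewrite (_ : cbox B = \bigcap_(p < d) [set x : pt R d | B p (coord x p)]).
  by apply: bigcap_measurableType => p pd; apply: measurable_coord_in; exact: mB.
by apply/seteqP; split => x /= H p; exact: H.
Qed.

Lemma cube_box : @cube R d = cbox (fun=> `[0, 1]%classic).
Proof. by apply/seteqP; split=> x H p pd; have := H p pd; rewrite /= in_itv. Qed.

Lemma orth_box J u :
  orth J u = cbox (fun p => if `[< J p >] then `]-oo, coord u p] else setT).
Proof.
apply/seteqP; split=> x /= H p pd.
  by case: asboolP => // Jp; rewrite /= in_itv /= H.
by move=> Jp; have := H p pd; case: asboolP => //= _; rewrite in_itv.
Qed.

Lemma measurable_orth J u : measurable (orth J u).
Proof. by rewrite orth_box; apply: measurable_box => p _; case: ifP. Qed.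

Lemma L_measurable_orth J u : L_measurable J (orth J u).
Proof.
split; first exact: measurable_orth.
by move=> x y xy xu p pd Jp; rewrite -xy //; exact: xu.
Qed.

Lemma L_measurable_sub J L A :
  (forall p, (p < d)%N -> L p -> J p) -> L_measurable L A -> L_measurable J A.
Proof.
move=> LJ [mA iA]; split=> // x y xy; apply: iA => p Lp.
by have [dp|pd] := leqP d p; [rewrite !coord_out|exact/xy/LJ].
Qed.

Lemma L_measurableT A : measurable A -> L_measurable all_coords A.
Proof. by move=> mA; split=> // x y xy; rewrite (@eq_coord x y)// => p _; exact: xy. Qed.

Lemma L_measurableI L A B :
  L_measurable L A -> L_measurable L B -> L_measurable L (A `&` B).
Proof.
move=> [mA iA] [mB iB]; split; first exact: measurableI.
by move=> x y xy [Ax Bx]; split; [exact: iA Ax|exact: iB Bx].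
Qed.

Lemma L_measurableC L A : L_measurable L A -> L_measurable L (~` A).
Proof.
move=> [mA iA]; split; first exact: measurableC.
by move=> x y xy nAx Ay; apply/nAx/(iA y x) => // p Lp; rewrite xy.
Qed.

Lemma L_measurable_bigcup L (I : countType) (F : I -> set (pt R d)) :
  (forall i, L_measurable L (F i)) -> L_measurable L (\bigcup_i F i).
Proof.
move=> mF; split.
  by apply: countable_bigcupT_measurable => // i; case: (mF i).
by move=> x y xy [i _ Fx]; exists i => //; case: (mF i) => _ /(_ x y xy Fx).
Qed.

Lemma L_measurable_coord_in (L : nat -> Prop) p (B : set R) : L p -> measurable B ->
  L_measurable L [set x : pt R d | B (coord x p)].
Proof.
by move=> Lp mB; split; [exact: measurable_coord_in|move=> x y xy /=; rewrite xy].
Qed.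

(** Used with independent [x] and [z] of one product law: the glued point has that law again, which
    makes conditioning on [L] explicit. *)
Definition mergeL L x z : pt R d :=
  [tuple if `[< L i >] then coord x i else coord z i | i < d].

Lemma coord_merge L x z p : (p < d)%N ->
  coord (mergeL L x z) p = if `[< L p >] then coord x p else coord z p.
Proof. by move=> pd; rewrite (coord_mktuple (fun i => if `[< L i >] then coord x i else coord z i)). Qed.

Lemma merge_in L x z p : L p -> coord (mergeL L x z) p = coord x p.
Proof.
move=> Lp; have [dp|pd] := leqP d p; first by rewrite !coord_out.
by rewrite coord_merge//; case: asboolP.
Qed.

Lemma merge_notin L x z p : ~ L p -> coord (mergeL L x z) p = coord z p.
Proof.
move=> Lp; have [dp|pd] := leqP d p; first by rewrite !coord_out.
by rewrite coord_merge//; case: asboolP.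
Qed.

Lemma eq_merge L x x' z : (forall p, L p -> coord x p = coord x' p) ->
  mergeL L x z = mergeL L x' z.
Proof.
by move=> xx; apply: eq_coord => p pd; rewrite !coord_merge//; case: asboolP => // /xx.
Qed.

Lemma measurable_merge L :
  measurable_fun setT (fun xz : pt R d * pt R d => mergeL L xz.1 xz.2).
Proof.
apply: (@measurable_mkcoord _ _ (fun i xz =>
  if `[< L i >] then coord xz.1 i else coord xz.2 i)) => p pd.
case: asboolP => _.
  exact: (measurableT_comp (measurable_coord p) measurable_fst).
exact: (measurableT_comp (measurable_coord p) measurable_snd).
Qed.

Lemma measurable_merge_l L z : measurable_fun setT (fun x => mergeL L x z).
Proof.
apply: (@measurable_mkcoord _ _ (fun i x =>
  if `[< L i >] then coord x i else coord z i)) => p pd; case: asboolP => _ //.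
exact: measurable_coord.
Qed.

Lemma measurable_merge_r L x : measurable_fun setT (mergeL L x).
Proof.
apply: (@measurable_mkcoord _ _ (fun i z =>
  if `[< L i >] then coord x i else coord z i)) => p pd; case: asboolP => _ //.
exact: measurable_coord.
Qed.

Definition rat_pt (v : d.-tuple rat) : pt R d := [tuple ratr (tnth v i) | i < d].

(** A countable pi-system of generators, so that an almost sure identity between kernels costs only
    countably many null sets. *)
Definition rat_orth : set (set (pt R d)) :=
  [set A | exists v, A = orth all_coords (rat_pt v)].

Lemma coord_rat_pt v (p : 'I_d) : coord (rat_pt v) p = ratr (tnth v p).
Proof. by rewrite coord_tnth tnth_mktuple. Qed.

Lemma measurable_rat_orthE : @measurable _ (pt R d) = <<s rat_orth >>.
Proof.
apply/seteqP; split; last first.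
  apply: smallest_sub; first exact: sigma_algebra_measurable.
  by move=> _ [v ->]; exact: measurable_orth.
pose G : set (set (pt R d)) := rat_orth.
pose T : measurableType _ := g_sigma_algebraType G.
(* A half-space is the union over [n] of the orthants whose other corner coordinates are [n]. *)
have mray (p : 'I_d) (q : rat) :
    @measurable _ T [set x | tnth (x : pt R d) p <= ratr q].
  rewrite (_ : [set _ | _] = \bigcup_n (orth all_coords
      (rat_pt [tuple if i == p then q else n%:R | i < d]))).
    apply: (@bigcupT_measurable _ T) => n; apply: sub_sigma_algebra; eapply ex_intro; reflexivity.
  apply/seteqP; split=> x /=; last first.
    move=> [n _ /(_ p (ltn_ord p) I)].
    by rewrite coord_rat_pt tnth_mktuple eqxx coord_tnth.
  move=> xp; pose M := \sum_(i < d) `|tnth (x : pt R d) i|.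
  have [n Mn] : exists n : nat, M <= n%:R.
    by exists (Num.truncn M).+1; rewrite ltW ?truncnS_gt.
  exists n => //= i id _; rewrite (coord_rat_pt _ (Ordinal id)) tnth_mktuple.
  have -> : coord x i = tnth x (Ordinal id) by rewrite -coord_tnth.
  case: eqP => [->//|_]; rewrite ratr_nat (le_trans _ Mn)//.
  rewrite (le_trans (ler_norm _))// /M (bigD1 (Ordinal id))//= lerDl.
  by apply: sumr_ge0.
(* Measurability of the identity is the remaining inclusion of sigma-algebras. *)
have mid : measurable_fun setT (id : T -> pt R d).
  apply/measurable_fun_tnthP => i.
  apply: (measurability _ (RGenOInfty.measurableE R)) => _ [_ [r ->]] <-.
  rewrite setTI (_ : _ @^-1` _ =
    \bigcup_(q : rat) (if r <= ratr q then ~` [set x : T | tnth (x : pt R d) i <= ratr q] else set0)).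
    apply: countable_bigcupT_measurable => // q.
    by case: ifP => // _; exact: measurableC.
  apply/seteqP; split=> x /=; rewrite in_itv /= andbT.
    move=> rx; have [q] := rat_in_itvoo rx.
    rewrite in_itv /= => /andP[rq qx]; exists q => //.
    by rewrite (ltW rq) /=; apply/negP; rewrite -ltNge.
  move=> [q _]; case: ifP => // rq /= /negP; rewrite -ltNge.
  exact: le_lt_trans.
by move=> A mA; have := mid measurableT A mA; rewrite setTI.
Qed.

Lemma probability_eq_rat (P Q : probability (pt R d) R) :
  (forall v, P (orth all_coords (rat_pt v)) = Q (orth all_coords (rat_pt v))) ->
  forall A, measurable A -> P A = Q A.
Proof.
move=> PQ; apply: (measure_unique rat_orth
  (fun n => orth all_coords (rat_pt [tuple n%:R | i < d]))).
- exact: measurable_rat_orthE.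
- move=> _ _ [v ->] [w ->].
  exists [tuple Num.min (tnth v i) (tnth w i) | i < d].
  apply/seteqP; split=> x /=.
    move=> [xv xw] p pd _; have := xv p pd I; have := xw p pd I.
    rewrite !(coord_rat_pt _ (Ordinal pd)) tnth_mktuple.
    by case: (leP (tnth v _)).
  move=> xvw; split=> p pd _; have := xvw p pd I;
    rewrite !(coord_rat_pt _ (Ordinal pd)) tnth_mktuple => /le_trans; apply;
    by rewrite ler_rat ge_min lexx ?orbT.
- by move=> n; eapply ex_intro; reflexivity.
- apply/seteqP; split=> // x _; pose M := \sum_(i < d) `|tnth x i|.
  have [n Mn] : exists n : nat, M <= n%:R.
    by exists (Num.truncn M).+1; rewrite ltW ?truncnS_gt.
  exists n => //= i id _; rewrite (coord_rat_pt _ (Ordinal id)) tnth_mktuple ratr_nat.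
  rewrite (coord_tnth _ (Ordinal id)) (le_trans _ Mn)// (le_trans (ler_norm _))//.
  by rewrite /M (bigD1 (Ordinal id))//= lerDl sumr_ge0.
- by move=> _ [v ->]; exact: PQ.
- by move=> n; rewrite (le_lt_trans (probability_le1 _ (measurable_orth _ _)))// ltry.
Qed.

End coordinates.

Section push.
Context d1 d2 (T1 : measurableType d1) (T2 : measurableType d2) (R : realType).

Definition push (P : probability T1 R) (f : T1 -> T2)
    (mf : measurable_fun setT f) : probability T2 R :=
  distribution P (mfun_Sub (mem_set mf)).

Lemma pushE P f mf A : @push P f mf A = P (f @^-1` A).
Proof. by []. Qed.

End push.
Arguments push {d1 d2 T1 T2 R} P {f} mf.
Global Opaque push.

(** * Equality of marginals *)

Section agreement.
Context (R : realType) (d : nat).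
Implicit Types (J L : nat -> Prop) (P Q : probability (pt R d) R).

(** All laws live on the whole space, while the recursion pins [nu i k] down only on its block. *)
Definition agree_on J P Q := forall A, L_measurable J A -> P A = Q A.

(** Resetting the coordinates outside [J] to 0 fixes every [J]-measurable set, so both laws may be
    pushed forward by this map. It pulls an orthant back to its [J]-part, or to the empty set if the
    corner has a negative coordinate outside [J]. *)
Lemma agree_on_rat J P Q :
  (forall v, P (orth J (rat_pt R v)) = Q (orth J (rat_pt R v))) -> agree_on J P Q.
Proof.
move=> PQ A [mA iA].
pose z : pt R d := [tuple 0 | i < d].
pose f x := mergeL J x z.
have mf : measurable_fun setT f by exact: measurable_merge_l.
have fA : f @^-1` A = A.
  apply/seteqP; split=> x /=; apply: iA => p Jp; by rewrite /f merge_in.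
rewrite -fA -(pushE P mf) -(pushE Q mf); apply: probability_eq_rat => // v.
rewrite (pushE P mf) (pushE Q mf).
have [v0|v0] := pselect (forall p, (p < d)%N -> ~ J p -> 0 <= coord (rat_pt R v) p).
  rewrite (_ : f @^-1` _ = orth J (rat_pt R v)); first exact: PQ.
  apply/seteqP; split=> x /= H p pd.
    by move=> Jp; have := H p pd I; rewrite merge_in.
  move=> _; rewrite /f; have [Jp|Jp] := pselect (J p).
    by rewrite merge_in//; exact: H.
  by rewrite merge_notin// /z (coord_mktuple (fun=> 0))//; exact: v0.
rewrite (_ : f @^-1` _ = set0) ?measure0//.
apply/seteqP; split=> // x /= H; apply: v0 => p pd Jp.
by have := H p pd I; rewrite /f merge_notin// /z (coord_mktuple (fun=> 0)).
Qed.

End agreement.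

(** * Product laws and independence *)

Section product_law.
Context (R : realType).
Implicit Types (m : nat -> probability R R) (B : nat -> set R).

Lemma prod_probE d1 d2 (T1 : measurableType d1) (T2 : measurableType d2)
    (P1 : probability T1 R) (P2 : probability T2 R) (A : set T1) (B : set T2) :
  measurable A -> measurable B ->
  (P1 \x P2 : probability _ R)%E (A `*` B) = (P1 A * P2 B)%E.
Proof. by move=> mA mB; exact: product_measure1E. Qed.

Definition box_rule d m (P : probability (pt R d) R) :=
  forall B, (forall p, measurable (B p)) ->
    P (cbox B) = (\prod_(p < d) m p (B p))%E.

Lemma ex_box_rule d m : exists P : probability (pt R d) R, box_rule m P.
Proof.
elim: d m => [|d IH] m.
  exists (dirac ([tuple] : pt R 0)) => B mB.
  by rewrite big_ord0 [LHS]diracE mem_set// => p.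
have [P HP] := IH (m \o S).
pose f (xy : R * pt R d) : pt R d.+1 := [tuple of xy.1 :: xy.2].
have mf : measurable_fun setT f by exact: measurable_cons.
exists (push (m 0%N \x P)%E mf) => B mB.
rewrite pushE (_ : f @^-1` _ = B 0%N `*` cbox (B \o S)).
  rewrite prod_probE//; last by apply: measurable_box => p _; exact: mB.
  by rewrite big_ord_recl HP// => p; exact: mB.
apply/seteqP; split=> [[a x]|[a x]] /=.
  by move=> H; split; [exact: (H 0%N)|move=> p pd; exact: (H p.+1)].
by move=> [H1 H2] [|p] pd //=; exact: H2.
Qed.

Context (d : nat) (m : nat -> probability R R) (P : probability (pt R d) R).
Hypothesis Pbox : box_rule m P.
Implicit Types (L : nat -> Prop) (A E : set (pt R d)).

Lemma box_rule_coord p (B : set R) : (p < d)%N -> measurable B ->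
  P [set x | B (coord x p)] = m p B.
Proof.
move=> pd mB.
pose C q := if q == p then B else setT.
have mC q : measurable (C q) by rewrite /C; case: ifP.
rewrite (_ : [set _ | _] = cbox C).
  rewrite Pbox// (bigD1 (Ordinal pd))//= /C eqxx big1 ?mule1// => i ip.
  by rewrite ifN ?probability_setT.
apply/seteqP; split=> x /=.
  by move=> Bx q _; rewrite /C; case: eqP => // ->.
by move/(_ p pd); rewrite /C eqxx.
Qed.

Lemma box_rule_coord2 p q (B C : set R) : (p < d)%N -> (q < d)%N -> p != q ->
  measurable B -> measurable C ->
  P [set x | B (coord x p) /\ C (coord x q)] = (m p B * m q C)%E.
Proof.
move=> pd qd pq mB mC.
pose D r := if r == p then B else if r == q then C else setT.
have mD r : measurable (D r) by rewrite /D; case: ifP => //; case: ifP.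
rewrite (_ : [set _ | _] = cbox D).
  rewrite Pbox// (bigD1 (Ordinal pd))//= {1}/D eqxx; congr (_ * _)%E.
  rewrite (bigD1 (Ordinal qd))/=; last by rewrite -val_eqE/= eq_sym.
  rewrite {1}/D eq_sym (negbTE pq) eqxx big1 ?mule1// => i /andP[ip iq].
  by rewrite -!val_eqE/= in ip iq; rewrite /D (negbTE ip) (negbTE iq) probability_setT.
apply/seteqP; split=> x /=.
  by move=> [Bx Cx] r _; rewrite /D; case: eqP => [->//|_]; case: eqP => // ->.
move=> H; have := H p pd; have := H q qd; rewrite /D !eqxx.
by rewrite eq_sym (negbTE pq).
Qed.

(** Both sides agree on boxes: the first copy tests the sides in [L], the second the others, and a
    full side has mass 1. *)
Lemma box_rule_merge L A : measurable A ->
  P A = (P \x P)%E [set xz | A (mergeL L xz.1 xz.2)].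
Proof.
move=> mA; have mf := @measurable_merge R d L.
rewrite -[RHS](pushE _ mf); apply: probability_eq_rat => // v.
rewrite (pushE (P \x P)%E) orth_box; set B := (X in cbox X).
have mB p : measurable (B p) by rewrite /B; case: ifP.
rewrite (_ : _ @^-1` _ = cbox (fun p => if `[< L p >] then B p else setT) `*`
                         cbox (fun p => if `[< L p >] then setT else B p)).
  rewrite prod_probE//; [|by apply: measurable_box => p _; case: ifP..].
  rewrite !Pbox//; [|by move=> p; case: ifP..].
  rewrite -big_split/=; apply: eq_bigr => i _.
  by case: ifP; rewrite probability_setT ?mul1e ?mule1.
apply/seteqP; split=> [[x z]|[x z]] /=.
  by move=> H; split=> p pd; have := H p pd; rewrite coord_merge//; case: ifP.
move=> [H1 H2] p pd; have := H1 p pd; have := H2 p pd.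
by rewrite coord_merge//; case: ifP.
Qed.

(** After gluing, [A] constrains only the first copy and [E] only the second, so the intersection
    becomes a rectangle. *)
Lemma box_rule_indep L A E : L_measurable L A -> L_measurable (fun p => ~ L p) E ->
  P (A `&` E) = (P A * P E)%E.
Proof.
move=> [mA iA] [mE iE].
rewrite (box_rule_merge L)//; last exact: measurableI.
rewrite (_ : [set _ | _] = A `*` E); first by rewrite product_measure1E.
apply/seteqP; split=> [[x z]|[x z]] /= [].
  move=> Ax Ez; split; [apply: iA Ax|apply: iE Ez] => p Lp.
    by rewrite merge_in.
  by rewrite merge_notin.
move=> Ax Ez; split; [apply: iA Ax|apply: iE Ez] => p Lp.
  by rewrite merge_in.
by rewrite merge_notin.
Qed.

End product_law.

(** * Uniform laws on intervals *)

Section uniform_law.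
Context (R : realType).
Implicit Types (a w t : R).

(** Distribution function of the uniform law on [0, 1]. *)
Definition clamp t : R := Num.max 0 (Num.min t 1).

Lemma clamp_itv t : 0 <= clamp t <= 1.
Proof. by rewrite /clamp le_max lexx /= ge_max ler01 /= ge_min lexx orbT. Qed.

Lemma clamp_id t : 0 <= t <= 1 -> clamp t = t.
Proof. by move=> /andP[t0 t1]; rewrite /clamp min_l// max_r. Qed.

Lemma clamp_ge1 t : 1 <= t -> clamp t = 1.
Proof. by move=> t1; rewrite /clamp min_r// max_r. Qed.

Lemma clamp_le0 t : t <= 0 -> clamp t = 0.
Proof. by move=> t0; rewrite /clamp max_l// ge_min t0. Qed.

Lemma continuous_clamp : continuous clamp.
Proof.
move=> t; apply: (@continuous_max _ _ (fun=> 0) (fun t => Num.min t 1)).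
  exact: cst_continuous.
apply: (@continuous_min _ _ id (fun=> 1)); last exact: cst_continuous.
exact: cvg_id.
Qed.

Local Notation unif01 := (uniform_prob (@ltr01 R)).

Lemma unif01_cdf t : unif01 [set x | x <= t] = (clamp t)%:E.
Proof.
rewrite /uniform_prob integral_uniform_pdf.
rewrite (_ : _ `&` _ = `[0, Num.min t 1]%classic); last first.
  apply/seteqP; split=> x /=; rewrite !in_itv/= le_min.
    by move=> [-> /andP[-> ->]].
  by move=> /andP[-> /andP[-> ->]].
rewrite (eq_integral (fun=> 1%:E)); last first.
  move=> x; rewrite inE/= in_itv/= le_min => /andP[x0 /andP[_ x1]].
  by rewrite /uniform_pdf x0 x1 subr0 invr1.
rewrite integral_cst//= mul1e.
have := @lebesgue_measure_itv R `[0, Num.min t 1]%R; rewrite /= => ->.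
rewrite lte_fin /clamp; case: ltP => h; first by rewrite oppr0 adde0.
by [].
Qed.

Lemma measurable_affine a w : measurable_fun setT (fun t : measurableTypeR R => a + w * t : R).
Proof. by apply: measurable_funD => //; exact: measurable_funM. Qed.

(** A pushforward rather than a density: [w = 0] then gives a point mass, which occurs for cells of
    mass zero. *)
Definition unif a w : probability R R := 
  push (unif01 : probability (measurableTypeR R) R) (measurable_affine a w).

Lemma unif_cdf a w t : 0 < w -> unif a w [set x | x <= t] = (clamp ((t - a) / w))%:E.
Proof.
move=> w0; rewrite -unif01_cdf pushE; congr (unif01 _).
apply/seteqP; split=> x /=; rewrite ler_pdivlMr// lerBrDl mulrC//.
Qed.

Lemma measurable_le t : measurable [set x : R | x <= t].
Proof. by rewrite -set_itvNyc. Qed.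

(** The probability integral transform, giving the margins of [condcop]. At [t = 1] the event is
    everything; for smaller [t] the truncation does not affect the comparison. *)
Lemma unif_cdf_le a w t : 0 < w -> 0 <= t <= 1 ->
  unif a w [set x | clamp ((x - a) / w) <= t] = t%:E.
Proof.
move=> w0 /andP[t0]; rewrite le_eqVlt => /orP[/eqP->|t1].
  rewrite (_ : [set _ | _] = setT) ?probability_setT//.
  by apply/seteqP; split=> // x _ /=; case/andP: (clamp_itv ((x - a) / w)).
rewrite -[RHS]/(t%:E) -{2}(@clamp_id t); last by rewrite t0 ltW.
rewrite (_ : t = (a + w * t - a) / w); last first.
  by rewrite addrC addKr mulrAC mulfV ?mul1r// gt_eqF.
rewrite -unif_cdf//; congr (unif a w _).
have -> : (a + w * t - a) / w = t.
  by rewrite addrC addKr mulrAC mulfV ?mul1r// gt_eqF.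
have key v : (clamp v <= t) = (v <= t).
  by rewrite /clamp ge_max t0 /= ge_min [1 <= t]leNgt t1 orbF.
by apply/seteqP; split=> x /=; rewrite key ler_pdivrMr// lerBlDl mulrC.
Qed.

(** Open on the left, so that intervals sharing an endpoint are disjoint, as [slab_inj] requires. *)
Lemma unif_support a w : 0 < w -> unif a w `]a, a + w]%classic = 1%:E.
Proof.
move=> w0.
rewrite (_ : `]a, a + w]%classic = [set x | x <= a + w] `\` [set x | x <= a]).
  have E t := @unif_cdf a w t w0.
  have fin : (unif a w [set x | (x <= a + w)%R] < +oo)%E by rewrite E ltry.
  rewrite measureD; [|exact: measurable_le|exact: measurable_le|exact: fin].
  rewrite (_ : _ `&` _ = [set x | x <= a]).
    rewrite [X in (X - _)%E](E (a + w)) [X in (_ - X)%E](E a) subrr mul0r.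
    rewrite [a + w]addrC addrK mulfV ?gt_eqF// clamp_ge1// clamp_le0//.
    by rewrite sube0.
  by apply/seteqP; split=> x /= => [[]//|xa]; split=> //; rewrite (le_trans xa)// lerDl ltW.
apply/seteqP; split=> x /=; rewrite in_itv/=.
  by move=> /andP[ax ->]; split=> //; apply/negP; rewrite -ltNge.
by move=> [-> /negP]; rewrite -ltNge => ->.
Qed.

End uniform_law.

(** * Finite mixtures *)

Section mixture.
Context dT (T : measurableType dT) (R : realType) (S : finType).
Context (w : S -> R) (P : S -> probability T R).
Hypotheses (w0 : forall s, 0 <= w s) (w1 : \sum_s w s = 1).

Lemma ex_mixture : exists Q : probability T R,
  (forall A, Q A = (\sum_s (w s)%:E * P s A)%E) /\
  (forall D (f : T -> \bar R), measurable D -> measurable_fun D f ->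
    (forall x, D x -> 0 <= f x)%E ->
    (\int[Q]_(x in D) f x = \sum_s (w s)%:E * \int[P s]_(x in D) f x)%E).
Proof.
(* The weights sum to 1, so [S] is inhabited; this supplies the default of [nth]. *)
have [s0] : exists s : S, True.
  have [/existsP[s _]|/existsPn h] := boolP [exists s : S, true]; first by exists s.
  by move: w1; rewrite big1 => [/eqP|s _]; [rewrite eq_sym oner_eq0|have := h s].
move=> _.
pose nth_s k := nth s0 (enum S) k.
pose m k : {measure set T -> \bar R} := mscale (NngNum (w0 (nth_s k))) (P (nth_s k)).
pose M := msum m #|S|.
have sumE (F : S -> \bar R) : (\sum_s F s = \sum_(k < #|S|) F (nth_s k))%E.
  by rewrite -big_enum/= (big_nth s0) cardE big_mkord.
have ME A : M A = (\sum_s (w s)%:E * P s A)%E by rewrite sumE.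
have M1 : M setT = 1%E.
  rewrite ME; under eq_bigr do rewrite probability_setT mule1.
  by rewrite sumEFin w1.
pose HM := Measure_isProbability.Build _ _ _ M M1.
pose Q : probability T R := HB.pack M HM.
exists Q; split=> // D f mD mf f0.
rewrite sumE ge0_integral_measure_sum//; apply: eq_bigr => k _.
by rewrite ge0_integral_mscale.
Qed.

End mixture.

(** * Integrals and null sets *)

Section integration.
Context dT (T : measurableType dT) (R : realType).
Local Open Scope ereal_scope.

(** The difference of [f] and [c] has constant sign and integral 0, hence vanishes almost everywhere
    on [A], where it is never 0. Applied where a conditional probability lies strictly above, or
    strictly below, its expected value. *)
Lemma integral_const_null (mu : probability T R) (A : set T) (f : T -> \bar R) (c : R) :
  measurable A -> measurable_fun setT f -> (forall x, 0 <= f x <= 1) ->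
  \int[mu]_(x in A) f x = c%:E * mu A ->
  (forall x, A x -> f x != c%:E) ->
  (forall x, A x -> f x <= c%:E) \/ (forall x, A x -> c%:E <= f x) -> mu A = 0.
Proof.
move=> mA mf f01 fc fA fAc.
have mfA : measurable_fun A f by exact: measurable_funTS.
have ffin x : f x \is a fin_num.
  by rewrite ge0_fin_numE; case/andP: (f01 x) => // _ /le_lt_trans; apply; rewrite ltry.
have fint : mu.-integrable A f.
  apply: (@le_integrable _ _ _ mu A mA f (cst 1)) => //.
    move=> x _; rewrite gee0_abs; last by case/andP: (f01 x).
    by rewrite /= normr1; case/andP: (f01 x).
  exact: finite_measure_integrable_cst.
have cint : mu.-integrable A (cst c%:E) by exact: finite_measure_integrable_cst.
have mfin : mu A \is a fin_num by exact: fin_num_measure.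
have ce : \int[mu]_(x in A) cst c%:E x = c%:E * mu A by rewrite integral_cst.
have int0 : \int[mu]_(x in A) `|f x - c%:E| = 0.
  case: fAc => h.
    rewrite (eq_integral (fun x => c%:E - f x)); last first.
      move=> x; rewrite inE => Ax; rewrite lee0_abs ?sube_le0 ?h//.
      by rewrite fin_num_oppeB// addeC.
    by rewrite (integralB mA cint fint) ce fc subee// fin_numM.
  rewrite (eq_integral (fun x => f x - c%:E)); last first.
    by move=> x; rewrite inE => Ax; rewrite gee0_abs// sube_ge0 ?h.
  by rewrite (integralB mA fint cint) ce fc subee// fin_numM.
have mfc : measurable_fun A (fun x => f x - c%:E) by exact: emeasurable_funB.
have h := @ae_eq_integral_abs _ _ _ mu A mA (fun x => f x - c%:E) mfc.
have /h := int0.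
move=> [N [mN N0 NA]].
apply/eqP; rewrite eq_le measure_ge0 andbT -N0.
apply: le_measure; rewrite ?inE// => x Ax; apply: NA => /= /(_ Ax).
rewrite -(fineK (ffin x)) -EFinD => -[] /eqP; rewrite subr_eq0 => /eqP fxc.
by have := fA x Ax; rewrite -(fineK (ffin x)) fxc eqxx.
Qed.

(* The function [f] is not assumed measurable: the integral of a nonnegative
   function is the supremum over the measurable simple functions below it. *)
Lemma ge0_ae_integral (mu : {measure set T -> \bar R}) (D N : set T) (f g : T -> \bar R) :
  measurable D -> measurable N -> mu N = 0 -> measurable_fun D g ->
  (forall x, D x -> 0 <= f x) -> (forall x, D x -> 0 <= g x) ->
  (forall x, D x -> ~ N x -> f x = g x) ->
  \int[mu]_(x in D) f x = \int[mu]_(x in D) g x.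
Proof.
move=> mD mN N0 mg f0 g0 fg.
have le_int (h k : T -> \bar R) : (forall x, D x -> 0 <= h x) ->
    (forall x, D x -> h x <= k x) ->
    \int[mu]_(x in D) h x <= \int[mu]_(x in D) k x.
  move=> h0 hk; rewrite !ge0_integralE//; last by move=> x Dx; exact: le_trans (h0 x Dx) (hk x Dx).
  apply: ereal_sup_le => _ [u uh <-]; exists u => // x.
  apply: le_trans (uh x) _; rewrite /patch; case: ifPn => //.
  by rewrite inE => /hk.
(* Measurable bounds of [f] from both sides: off [N] they equal [g], on [N] they take the extreme
   values. *)
pose glow x := if x \in N then 0 else g x.
pose gup x := if x \in N then +oo else g x.
have aeg (k : T -> \bar R) : measurable_fun D k -> (forall x, ~ N x -> k x = g x) ->
    \int[mu]_(x in D) k x = \int[mu]_(x in D) g x.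
  move=> mk kg; apply: ae_eq_integral => //.
  by exists N; split=> // x /=; apply: contra_notP => nN _; exact: kg.
have mNp : measurable_fun D (fun x => x \in N).
  apply: measurable_funTS; apply: (measurable_fun_bool true).
  rewrite setTI (_ : _ @^-1` _ = N)//; by apply/seteqP; split=> [x /= /set_mem|x /= /mem_set].
have mlow : measurable_fun D glow.
  apply: measurable_fun_if => //.
  by apply: measurable_funS mg => //; apply: subIsetl.
have mup : measurable_fun D gup.
  apply: measurable_fun_if => //.
  by apply: measurable_funS mg => //; apply: subIsetl.
have lowE : \int[mu]_(x in D) glow x = \int[mu]_(x in D) g x.
  by apply: aeg => // x Nx; rewrite /glow memNset.
have upE : \int[mu]_(x in D) gup x = \int[mu]_(x in D) g x.
  by apply: aeg => // x Nx; rewrite /gup memNset.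
apply/eqP; rewrite eq_le -{1}upE -{1}lowE; apply/andP; split.
  apply: le_int => // x Dx; rewrite /gup; case: ifPn => [_|]; first exact: leey.
  by rewrite notin_setE => Nx; rewrite fg.
apply: le_int => x Dx; rewrite /glow; case: ifPn => //.
- by move=> _; exact: g0.
- by move=> _; exact: f0.
- by rewrite notin_setE => Nx; rewrite fg.
Qed.

End integration.

(** * Mixtures of uniform laws on boxes with disjoint projections *)

Section mixture_of_boxes.
Context (R : realType) (d : nat) (S : finType).
Context (w : S -> R) (a : S -> nat -> R) (P : S -> probability (pt R d) R).
Context (Q : probability (pt R d) R).
Hypotheses (w0 : forall s, 0 <= w s) (w1 : \sum_s w s = 1).
Hypothesis a_disj : forall s t p, s != t -> (p < d)%N ->
  a s p + w s <= a t p \/ a t p + w t <= a s p.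
Hypothesis Pbox : forall s, box_rule (fun p => unif (a s p) (w s)) (P s).
Hypothesis QE : forall A, Q A = (\sum_s (w s)%:E * P s A)%E.
Hypothesis Qint : forall D (f : pt R d -> \bar R), measurable D -> measurable_fun D f ->
    (forall x, D x -> 0 <= f x)%E ->
    (\int[Q]_(x in D) f x = \sum_s (w s)%:E * \int[P s]_(x in D) f x)%E.
Implicit Types (J L : nat -> Prop) (A E : set (pt R d)) (l : nat).

Definition slab l s : set (pt R d) := [set x | `]a s l, a s l + w s]%classic (coord x l)].

Lemma L_measurable_slab L l s : L l -> L_measurable L (slab l s).
Proof. by move=> Ll; exact: L_measurable_coord_in. Qed.

Lemma measurable_slab l s : measurable (slab l s).
Proof. exact: measurable_coord_in. Qed.

Lemma slab_inj l s t x : (l < d)%N -> slab l s x -> slab l t x -> s = t.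
Proof.
move=> ld; rewrite /slab /= !in_itv /= => /andP[s1 s2] /andP[t1 t2].
apply/eqP; apply: contraT => st; have [h|h] := a_disj st ld.
  by have := lt_le_trans t1 (le_trans s2 h); rewrite ltxx.
by have := lt_le_trans s1 (le_trans t2 h); rewrite ltxx.
Qed.

Lemma P_slab l s : (l < d)%N -> 0 < w s -> P s (slab l s) = 1%E.
Proof.
by move=> ld ws; rewrite /slab (box_rule_coord (Pbox s))// unif_support.
Qed.

Lemma P_slabC l s : (l < d)%N -> 0 < w s -> P s (~` slab l s) = 0%E.
Proof.
move=> ld ws; rewrite probability_setC ?P_slab ?subee//; exact: measurable_slab.
Qed.

Lemma P_slabI l s A : (l < d)%N -> 0 < w s -> measurable A ->
  P s (A `&` slab l s) = P s A.
Proof.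
move=> ld ws mA; have mG := measurable_slab l s.
have -> : P s A = (P s (A `&` slab l s) + P s (A `&` ~` slab l s))%E.
  rewrite -measureU; [by rewrite -setIUr setUCr setIT| | |].
  - exact: measurableI.
  - by apply: measurableI => //; exact: measurableC.
  - by apply/seteqP; split=> // x /= [[_ ?] [_]].
rewrite [X in (_ + X)%E](_ : _ = 0%E) ?adde0//.
apply/eqP; rewrite eq_le measure_ge0 andbT -(P_slabC ld ws).
have mGC := measurableC mG.
by apply: le_measure; rewrite ?inE//; exact: measurableI.
Qed.

(** Up to null sets [slab l s] is the event that the point was drawn from component [s]: [P s] is
    carried by it, the other components of positive weight by disjoint slabs. *)
Lemma Q_slabI l s A : (l < d)%N -> measurable A ->
  Q (A `&` slab l s) = ((w s)%:E * P s A)%E.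
Proof.
move=> ld mA; rewrite QE (bigD1 s)//= big1 ?adde0.
  have := w0 s; rewrite le_eqVlt => /orP[/eqP <-|ws]; first by rewrite !mul0e.
  by rewrite P_slabI.
move=> t ts; have := w0 t; rewrite le_eqVlt => /orP[/eqP <-|wt]; first by rewrite mul0e.
rewrite (_ : P t _ = 0%E) ?mule0//.
apply/eqP; rewrite eq_le measure_ge0 andbT -(P_slabC ld wt).
have mG := measurable_slab.
apply: le_measure; rewrite ?inE//; [exact: measurableI|exact: measurableC|].
by move=> x [_ sx] /(slab_inj ld sx) ets; rewrite ets eqxx in ts.
Qed.

Definition no_slab l : set (pt R d) :=
  ~` \bigcup_s (if 0 < w s then slab l s else set0).

Lemma L_measurable_no_slab L l : L l -> L_measurable L (no_slab l).
Proof.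
move=> Ll; apply/L_measurableC/L_measurable_bigcup => s.
case: ifP => _; first exact: L_measurable_slab.
by split.
Qed.

Lemma Q_no_slab l : (l < d)%N -> Q (no_slab l) = 0%E.
Proof.
move=> ld; rewrite QE big1// => s _.
have := w0 s; rewrite le_eqVlt => /orP[/eqP <-|ws]; first by rewrite mul0e.
rewrite (_ : P s _ = 0%E) ?mule0//.
apply/eqP; rewrite eq_le measure_ge0 andbT -(P_slabC ld ws).
have mG := measurable_slab.
have [mN _] := @L_measurable_no_slab all_coords l I.
apply: le_measure; rewrite ?inE//; first exact: measurableC.
by move=> x nx sx; apply: nx; exists s => //; rewrite ws.
Qed.

Lemma L_measurable_level L A (f : pt R d -> \bar R) (B : set (\bar R)) :
  L_measurable L A ->
  (forall x y, (forall p, L p -> coord x p = coord y p) -> f x = f y) ->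
  measurable_fun setT f -> measurable B -> L_measurable L (A `&` f @^-1` B).
Proof.
move=> mA fL mf mB; apply: L_measurableI => //; split.
  by rewrite -[X in measurable X]setTI; exact: mf.
by move=> x y xy /=; rewrite (fL x y).
Qed.

(* Any coordinate in [L] tells which component [s] the point comes from, and
   the coordinates are independent under each component: the conditional law
   given [L] of the coordinates outside [L] is that of the component. *)
Lemma rcd_mixture J L nu kappa l : (l < d)%N -> L l ->
  (forall p, (p < d)%N -> L p -> J p) -> agree_on J nu Q -> rcd nu L kappa ->
  exists N, [/\ L_measurable L N, Q N = 0%E & forall x, ~ N x ->
    exists s, [/\ 0 < w s, slab l s x &
      forall E, L_measurable (fun p => J p /\ ~ L p) E -> kappa x E = P s E]].
Proof.
move=> ld Ll LJ nuQ [kL [mk kint]].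
pose Ev v := orth (fun p => J p /\ ~ L p) (rat_pt R v) : set (pt R d).
have mEv v : measurable (Ev v) by exact: measurable_orth.
pose c v s := fine (P s (Ev v)).
have cE v s : P s (Ev v) = (c v s)%:E by rewrite fineK//; exact: fin_num_measure.
(* The sets where the kernel errs on orthant [v], split by sign as [integral_const_null] requires.
   Both are [L]-measurable, so the kernel equation applies to them. *)
pose lo v s := slab l s `&` (fun x => kappa x (Ev v)) @^-1` [set y | (y < (c v s)%:E)%E].
pose hi v s := slab l s `&` (fun x => kappa x (Ev v)) @^-1` [set y | ((c v s)%:E < y)%E].
have nullQ v s A : 0 < w s -> L_measurable L A -> A `<=` slab l s ->
    (forall x, A x -> kappa x (Ev v) != (c v s)%:E) ->
    (forall x, A x -> kappa x (Ev v) <= (c v s)%:E)%E \/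
    (forall x, A x -> (c v s)%:E <= kappa x (Ev v))%E -> Q A = 0%E.
  move=> ws mA As kne kcmp.
  have EJ : L_measurable (fun p => J p /\ ~ L p) (Ev v) by exact: L_measurable_orth.
  have E1 : L_measurable J (Ev v) by apply: L_measurable_sub EJ => p _ [].
  have E2 : L_measurable (fun p => ~ L p) (Ev v) by apply: L_measurable_sub EJ => p _ [].
  have AJ : L_measurable J A by exact: L_measurable_sub mA.
  have mA' : measurable A by case: mA.
  rewrite -nuQ//; apply: (@integral_const_null _ _ _ nu A (fun x => kappa x (Ev v)) (c v s)) => //.
  - exact: mk.
  - by move=> x; rewrite measure_ge0 probability_le1.
  rewrite -kint// nuQ ?(nuQ A)//; last exact: L_measurableI.
  (* Inside the slab only component [s] counts, and there [A] and [Ev v] are independent. *)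
  have -> : A = A `&` slab l s by apply/esym/setIidPl.
  rewrite setIAC Q_slabI//; last exact: measurableI.
  by rewrite (box_rule_indep (Pbox s) mA E2) Q_slabI// cE muleA muleC.
have mlo v s : L_measurable L (lo v s).
  apply: L_measurable_level; [exact: L_measurable_slab|by move=> x y /kL ->|exact: mk|].
  by rewrite -set_itvNyo; exact: emeasurable_itv.
have mhi v s : L_measurable L (hi v s).
  apply: L_measurable_level; [exact: L_measurable_slab|by move=> x y /kL ->|exact: mk|].
  by rewrite -set_itvoy; exact: emeasurable_itv.
have lo0 v s : 0 < w s -> Q (lo v s) = 0%E.
  move=> ws; apply: (nullQ v s _ ws (mlo v s)) => [x []//|x [_ /lt_eqF/negbT]//|].
  by left=> x [_ /ltW].
have hi0 v s : 0 < w s -> Q (hi v s) = 0%E.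
  move=> ws; apply: (nullQ v s _ ws (mhi v s)) => [x []//|x [_ /gt_eqF/negbT]//|].
  by right=> x [_ /ltW].
(* Countably many failures: one for each rational orthant and component of positive weight. *)
pose F (vs : (d.-tuple rat * S)%type) :=
  if 0 < w vs.2 then lo vs.1 vs.2 `|` hi vs.1 vs.2 else set0.
have mF vs : L_measurable L (F vs).
  rewrite /F; case: ifP => _; last by split.
  rewrite -[_ `|` _]setCK setCU; apply/L_measurableC/L_measurableI; exact/L_measurableC.
have F0 vs : Q (F vs) = 0%E.
  rewrite /F; case: ifP => ws; last by rewrite measure0.
  by apply: null_set_setU; [case: (mlo vs.1 vs.2)|case: (mhi vs.1 vs.2)|exact: lo0|exact: hi0].
exists (no_slab l `|` \bigcup_vs F vs); split.
- rewrite -[_ `|` _]setCK setCU; apply/L_measurableC/L_measurableI; apply/L_measurableC.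
    exact: L_measurable_no_slab.
  exact: L_measurable_bigcup.
- apply: null_set_setU.
  + by case: (@L_measurable_no_slab L l Ll).
  + by case: (L_measurable_bigcup mF).
  + exact: Q_no_slab.
  + apply: (@measure_negligible _ _ _ Q); first by case: (L_measurable_bigcup mF).
  have [f finj] : exists f : (d.-tuple rat * S)%type -> nat, injective f.
    by exists pickle; exact: (pcan_inj pickleK).
  rewrite (_ : \bigcup_vs F vs = \bigcup_n (if unpickle n is Some vs then F vs else set0)).
    apply: negligible_bigcup => n; case: unpickle => [vs|]; last exact: negligible_set0.
    by apply/negligibleP; [case: (mF vs)|exact: F0].
  apply/seteqP; split=> x [].
    by move=> vs _ Fx; exists (pickle vs) => //; rewrite pickleK.
  by move=> n _; case: unpickle => // vs Fx; exists vs.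
move=> x /not_orP[/contrapT[s _]]; case: ifPn => // ws sx nF.
exists s; split=> //; apply: agree_on_rat => v.
have : ~ F (v, s) x by move=> Fx; apply: nF; exists (v, s).
rewrite /F /= ws => /not_orP[nlo nhi].
rewrite -/(Ev v) cE; apply/eqP; rewrite eq_le !leNgt; apply/andP; split; apply/negP => h.
  by apply: nhi; split.
by apply: nlo; split.
Qed.

Section ex_rcd.
Context (L : nat -> Prop) (l : nat) (s0 : S).
Hypotheses (ld : (l < d)%N) (Ll : L l).

(** The default [s0] is used only on the null set [no_slab l]. *)
Let sel (x : pt R d) := odflt s0 [pick s | (0 < w s) && (x \in slab l s)].

Let selE s x : 0 < w s -> slab l s x -> sel x = s.
Proof.
move=> ws sx; rewrite /sel; case: pickP => [t /andP[wt]|/(_ s)].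
  by rewrite inE /= => tx; exact: slab_inj tx sx.
by rewrite ws mem_set.
Qed.

Let selL x y : (forall p, L p -> coord x p = coord y p) -> sel x = sel y.
Proof.
move=> xy; rewrite /sel; congr odflt; apply: eq_pick => s.
by congr (_ && _); apply/idP/idP; rewrite !inE /slab /= xy.
Qed.

Let measurable_sel s : measurable [set x | sel x = s].
Proof.
rewrite (_ : [set _ | _] = (if 0 < w s then slab l s else set0) `|`
                           (if s == s0 then no_slab l else set0)).
  apply: measurableU; case: ifP => // _; first exact: measurable_slab.
  by case: (@L_measurable_no_slab L l Ll).
apply/seteqP; split=> x /=.
  rewrite /sel; case: pickP => [t /andP[wt tx]|no] /= ts.
    by left; rewrite -ts wt; move: tx; rewrite inE.
  right; rewrite ts eqxx => -[t _]; case: ifP => // wt tx.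
  by have := no t; rewrite wt mem_set.
case.
  by case: ifP => // ws; exact: selE.
case: ifP => // /eqP -> nx.
rewrite /sel; case: pickP => // t /andP[wt]; rewrite inE => tx.
by exfalso; apply: nx; exists t => //; rewrite wt.
Qed.

(** A fresh draw from the component revealed by [x] that keeps the [L]-coordinates of [x]: the
    kernel must also be right on events involving [L]. *)
Let kappa (x : pt R d) : probability (pt R d) R := push (P (sel x)) (@measurable_merge_r R d L x).

Let Msec E : set (pt R d * pt R d) := [set xz | E (mergeL L xz.1 xz.2)].

Let measurable_Msec E : measurable E -> measurable (Msec E).
Proof.
by move=> mE; rewrite -[Msec E]setTI; exact: (@measurable_merge R d L).
Qed.

Let kappaE x E : kappa x E = P (sel x) (xsection (Msec E) x).
Proof.
rewrite /kappa pushE; congr (P _ _).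
by apply/seteqP; split=> z; rewrite /xsection /= inE.
Qed.

Let measurable_sec s E : measurable E ->
  measurable_fun setT (fun x => P s (xsection (Msec E) x)).
Proof. by move=> mE; apply: measurable_fun_xsection; exact: measurable_Msec. Qed.

Let measurable_kappa E : measurable E -> measurable_fun setT (fun x => kappa x E).
Proof.
move=> mE _ B mB; rewrite setTI.
rewrite (_ : _ @^-1` _ = \bigcup_s ([set x | sel x = s] `&`
    (fun x => P s (xsection (Msec E) x)) @^-1` B)).
  apply: countable_bigcupT_measurable => // s; apply: measurableI; first exact: measurable_sel.
  by rewrite -[X in measurable X]setTI; exact: measurable_sec.
apply/seteqP; split=> x /=; rewrite kappaE; first by exists (sel x).
by move=> [s _ [<-]].
Qed.

Lemma rcd_kernel : exists kappa, rcd Q L kappa.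
Proof.
exists kappa; split.
  move=> x y xy E; rewrite !kappaE (selL xy); congr (P _ _).
  by apply/seteqP; split=> z; rewrite /xsection /= !inE /Msec /= (eq_merge z xy).
split; first exact: measurable_kappa.
move=> A E mA mE; have [mA' iA] := mA.
rewrite QE Qint//; last by apply: measurable_funTS; exact: measurable_kappa.
apply: eq_bigr => s _.
have := w0 s; rewrite le_eqVlt => /orP[/eqP <-|ws]; first by rewrite !mul0e.
congr (_ * _)%E.
(* Under [P s] the selected component is almost surely [s]; what remains is [box_rule_merge], with
   the product measure written as an iterated integral. *)
rewrite (@ge0_ae_integral _ _ _ (P s) A (~` slab l s) _
    (fun x => P s (xsection (Msec E) x)))//.
- rewrite (box_rule_merge (Pbox s) L); last exact: measurableI.
  rewrite /product_measure1 [RHS]integral_mkcond; apply: eq_integral => x _ /=.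
  rewrite /patch; case: ifPn => [|]; rewrite ?inE ?notin_setE => Ax.
    congr (P s _); apply/seteqP; split=> z; rewrite /xsection /= !inE /=.
      by case.
    by move=> Ez; split=> //; apply: iA Ax => p Lp; rewrite merge_in.
  rewrite (_ : xsection _ _ = set0) ?measure0//.
  apply/seteqP; split=> z //; rewrite /xsection /= !inE /= => -[Az _].
  by apply: Ax; apply: iA Az => p Lp; rewrite merge_in.
- by apply: measurableC; exact: measurable_slab.
- exact: P_slabC.
- by apply: measurable_funTS; exact: measurable_sec.
- by move=> x Ax /contrapT sx; rewrite kappaE (selE ws sx).
Qed.

End ex_rcd.

Lemma ex_rcd_mixture L l : (l < d)%N -> L l -> exists kappa, rcd Q L kappa.
Proof.
move=> ld Ll; have [s0] : exists s : S, True.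
  have [/existsP[s _]|/existsPn h] := boolP [exists s : S, true]; first by exists s.
  by move: w1; rewrite big1 => [/eqP|s _]; [rewrite eq_sym oner_eq0|have := h s].
by move=> _; exact: rcd_kernel s0 ld Ll.
Qed.

Definition Fs s p t : R := clamp ((t - a s p) / w s).

Lemma P_coord_le s p t : (p < d)%N -> 0 < w s ->
  P s [set x | coord x p <= t] = (Fs s p t)%:E.
Proof.
move=> pd ws.
by rewrite (box_rule_coord (Pbox s) pd (measurable_le t)) unif_cdf.
Qed.

(** [K] is the set of coordinates on which the kernel at [x] is known to follow component [s]. *)
Lemma cdf1_mixture (kappa : pt R d -> probability (pt R d) R) s (K : nat -> Prop) x p t : (p < d)%N -> 0 < w s -> K p ->
  (forall E, L_measurable K E -> kappa x E = P s E) ->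
  cdf1 kappa p x t = Fs s p t.
Proof.
move=> pd ws Kp kP; rewrite /cdf1 kP ?P_coord_le//.
by apply: (@L_measurable_coord_in R d K p [set y | y <= t] Kp); exact: measurable_le.
Qed.

Lemma measurable_Fs_le s p c : measurable [set y | Fs s p y <= c].
Proof.
have mF : measurable_fun setT (Fs s p).
  rewrite /Fs; apply: (@measurableT_comp _ _ _ _ _ _ (clamp (R:=R))).
    exact: continuous_measurable_fun (@continuous_clamp R).
  by apply: measurable_funM => //; exact: measurable_funB.
have := mF measurableT _ (measurable_le c); by rewrite setTI.
Qed.

(** The transformed coordinates are uniform by [unif_cdf_le] and independent under component [s]. *)
Lemma condcop_mixture (kappa : pt R d -> probability (pt R d) R) s (K : nat -> Prop) x p q b c :
  (p < d)%N -> (q < d)%N -> p != q -> 0 < w s -> K p -> K q ->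
  (forall E, L_measurable K E -> kappa x E = P s E) ->
  0 <= b <= 1 -> 0 <= c <= 1 -> condcop kappa p q x b c = b * c.
Proof.
move=> pd qd pq ws Kp Kq kP b01 c01; rewrite /condcop.
rewrite (_ : [set _ | _] = [set z | Fs s p (coord z p) <= b /\ Fs s q (coord z q) <= c]).
  rewrite kP; last first.
    apply: L_measurableI.
      exact: (@L_measurable_coord_in R d K p [set y | Fs s p y <= b] Kp (measurable_Fs_le _ _ _)).
    exact: (@L_measurable_coord_in R d K q [set y | Fs s q y <= c] Kq (measurable_Fs_le _ _ _)).
  rewrite (box_rule_coord2 (Pbox s) pd qd pq (measurable_Fs_le s p b) (measurable_Fs_le s q c)).
  by rewrite !unif_cdf_le.
by apply/seteqP; split=> z /=; rewrite (cdf1_mixture _ pd ws Kp kP) (cdf1_mixture _ qd ws Kq kP).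
Qed.

(** The integrand is constant off an [L]-measurable set that is null for [Q], hence null for every
    [nuM] with the same [L]-marginal. *)
Lemma Cpart_mixture L l kappa nuM p q b c : (l < d)%N -> L l -> rcd Q L kappa ->
  agree_on L nuM Q -> (p < d)%N -> (q < d)%N -> p != q -> ~ L p -> ~ L q ->
  0 <= b <= 1 -> 0 <= c <= 1 -> Cpart kappa nuM p q b c = b * c.
Proof.
move=> ld Ll rQ nuQ pd qd pq Lp Lq b01 c01.
have [//|N [mN N0 HN]] :=
  @rcd_mixture all_coords L Q kappa l ld Ll (fun _ _ _ => I) _ rQ.
rewrite /Cpart (@ge0_ae_integral _ _ _ nuM setT N _ (cst (b * c)%:E))//.
- have -> : (\int[nuM]_x cst (b * c)%:E x = (b * c)%:E)%E; last by [].
  by rewrite integral_cst// -[RHS]mule1; congr (_ * _)%E; exact: probability_setT.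
- by case: mN.
- exact: etrans (nuQ N mN) N0.
- by move=> x _; rewrite lee_fin; exact: fine_ge0.
- by move=> x _; rewrite lee_fin mulr_ge0//; [case/andP: b01|case/andP: c01].
- move=> x _ /HN[s [ws sx kP]]; congr EFin.
  by apply: (@condcop_mixture _ s (fun r => all_coords r /\ ~ L r)).
Qed.

(** Given the component, the two end coordinates are independent of each other and of the block
    between them. Stated for laws that agree with [Q] on their blocks, the step serves existence and
    uniqueness alike. *)
Lemma pvc_step i k u nu1 nu2 nuM k1 k2 k3 : (i + k.+2 < d)%N ->
  agree_on (blk i k.+1) nu1 Q -> agree_on (blk i.+1 k.+1) nu2 Q ->
  agree_on (blk i.+1 k) nuM Q ->
  rcd nu1 (blk i.+1 k) k1 -> rcd nu2 (blk i.+1 k) k2 -> rcd Q (blk i.+1 k) k3 ->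
  (\int[nuM]_(x in orth (blk i.+1 k) u)
     (Cpart k3 nuM i (i + k.+2) (cdf1 k1 i x (coord u i))
        (cdf1 k2 (i + k.+2) x (coord u (i + k.+2))))%:E)%E =
  Q (orth (blk i k.+2) u).
Proof.
move=> ikd nu1Q nu2Q nuMQ r1 r2 r3.
set q := (i + k.+2)%N; set L := blk i.+1 k.
have ld : (i.+1 < d)%N by lia.
have Ll : L i.+1 by rewrite /L /blk; lia.
have id : (i < d)%N by lia.
have iq : i != q by rewrite /q; lia.
have Li : ~ L i by rewrite /L /blk; lia.
have Lq : ~ L q by rewrite /L /blk /q; lia.
have sub1 p : (p < d)%N -> L p -> blk i k.+1 p by rewrite /L /blk; lia.
have sub2 p : (p < d)%N -> L p -> blk i.+1 k.+1 p by rewrite /L /blk; lia.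
have [N1 [mN1 N10 HN1]] := rcd_mixture ld Ll sub1 nu1Q r1.
have [N2 [mN2 N20 HN2]] := rcd_mixture ld Ll sub2 nu2Q r2.
have mN : L_measurable L (N1 `|` N2).
  by rewrite -[_ `|` _]setCK setCU; apply/L_measurableC/L_measurableI; exact/L_measurableC.
(* The value of the integrand on the slab of [s]; it is set to 0 for weight zero, where [Fs] divides
   by 0. *)
pose c s := if 0 < w s then Fs s i (coord u i) * Fs s q (coord u q) else 0.
have F01 s p t : 0 <= Fs s p t <= 1 by exact: clamp_itv.
have c0 s : 0 <= c s.
  by rewrite /c; case: ifP => // _; rewrite mulr_ge0//; [case/andP: (F01 s i (coord u i))|case/andP: (F01 s q (coord u q))].
have mslab := measurable_slab.
have mt s : measurable_fun setT (fun x => ((c s)%:E * (\1_(slab i.+1 s) x)%:E)%E).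
  by apply: measurable_funeM; apply/measurable_EFinP; exact: measurable_indic.
have t0 s x : (0 <= (c s)%:E * (\1_(slab i.+1 s) x)%:E)%E.
  by rewrite mule_ge0// lee_fin.
pose g x := (\sum_s (c s)%:E * (\1_(slab i.+1 s) x)%:E)%E.
have mD : measurable (orth L u) by exact: measurable_orth.
have mNN : measurable (N1 `|` N2) by case: mN.
rewrite (@ge0_ae_integral _ _ _ nuM _ (N1 `|` N2) _ g)//.
- rewrite /g ge0_integral_sum//; last by move=> s; exact: measurable_funTS.
  rewrite QE; apply: eq_bigr => s _.
  rewrite ge0_integralZl//; last 2 first.
  + by apply: measurable_funTS; apply/measurable_EFinP; exact: measurable_indic.
  + by rewrite lee_fin.
  have mDs : L_measurable L (orth L u `&` slab i.+1 s).
    apply: L_measurableI; first exact: L_measurable_orth.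
    exact: L_measurable_slab.
  rewrite integral_indic// setIC [X in (_ * X)%E](etrans (nuMQ _ mDs) (Q_slabI s ld mD)).
  have := w0 s; rewrite le_eqVlt => /orP[/eqP <-|ws]; first by rewrite !mul0e mule0.
  rewrite /c ws muleCA; congr (_ * _)%E.
  have -> : orth (blk i k.+2) u = orth L u `&`
      [set x | coord x i <= coord u i /\ coord x q <= coord u q].
    apply/seteqP; split=> x /=.
      move=> H; split=> [p pd Lp|]; first by apply: H => //; move: Lp; rewrite /L /blk; lia.
      by split; apply: H => //; rewrite /blk /q; lia.
    move=> [HL [Hi Hq]] p pd Hp.
    have [->//|pi] := eqVneq p i; have [->//|pq] := eqVneq p q.
    by apply: HL => //; move: Hp pi pq; rewrite /L /blk /q; lia.
  rewrite (@box_rule_indep _ _ _ _ (Pbox s) L); last 2 first.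
  + exact: L_measurable_orth.
  + apply: L_measurableI.
      exact: (@L_measurable_coord_in R d (fun p => ~ L p) i [set y | y <= _] Li (measurable_le _)).
    exact: (@L_measurable_coord_in R d (fun p => ~ L p) q [set y | y <= _] Lq (measurable_le _)).
  rewrite (box_rule_coord2 (Pbox s) id ikd iq (measurable_le _) (measurable_le _)).
  by rewrite !unif_cdf// muleC.
- apply: (etrans (nuMQ _ mN)).
  by apply: null_set_setU; [case: mN1|case: mN2| |].
- rewrite /g; apply: emeasurable_sum => s; exact: measurable_funTS.
- move=> x _; rewrite lee_fin; apply: fine_ge0; apply: integral_ge0 => y _.
  by rewrite lee_fin; exact: fine_ge0.
- by move=> x _; rewrite /g sume_ge0.
- move=> x _ /not_orP[/HN1[s [ws sx kP1]] /HN2[t [wt tx kP2]]].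
  (* [x] lies in one slab only, so both kernels follow the same component. *)
  rewrite -(slab_inj ld sx tx) in kP2.
  rewrite (cdf1_mixture _ id ws _ kP1); last by split=> //; rewrite /blk; lia.
  rewrite (cdf1_mixture _ ikd ws _ kP2); last by split=> //; rewrite /blk /q; lia.
  rewrite (Cpart_mixture ld Ll r3)// /g (bigD1 s)//= big1 ?adde0.
    by rewrite /c ws indicE mem_set// mule1.
  move=> r rs; rewrite indicE memNset ?mule0// => rx.
  by rewrite (slab_inj ld rx sx) eqxx in rs.
Qed.

Hypothesis Qcop : is_copula_measure Q.

(** Copulas and the recursion are constrained at corners in the cube only. Both laws give full mass
    to the [J]-orthant with corner 1, so a corner may be clamped; a negative coordinate in [J] gives
    a null set, as the margins of [Q] have no mass on the negative axis. *)
Lemma agree_cube J (nu : probability (pt R d) R) :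
  (forall u, cube u -> nu (orth J u) = Q (orth J u)) -> agree_on J nu Q.
Proof.
move=> nuQ; have [Qcube Qmarg] := Qcop.
pose one : pt R d := [tuple 1 | i < d].
have cone : cube one.
  by move=> p pd; rewrite (coord_mktuple (fun=> 1))// lexx ler01.
have mO (u : pt R d) : measurable (orth J u) by exact: measurable_orth.
have mcube : measurable (@cube R d).
  by rewrite cube_box; exact: measurable_box.
have Q1 : Q (orth J one) = 1%E.
  apply/eqP; rewrite eq_le probability_le1//= -Qcube.
  apply: le_measure; rewrite ?inE// => x xc p pd _.
  by rewrite (coord_mktuple (fun=> 1))//; case/andP: (xc p pd).
have restr (m : probability (pt R d) R) A : measurable A -> m (orth J one) = 1%E ->
    m A = m (A `&` orth J one).
  move=> mA m1; rewrite -[in LHS](setIT A) -(setUCr (orth J one)) setIUr.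
  have mC := measurableC (mO one).
  rewrite measureU; [|exact: measurableI|exact: measurableI|]; last first.
    by apply/seteqP; split=> // x [[_ ?] [_]].
  rewrite [X in (_ + X)%E](_ : _ = 0%E) ?adde0//.
  apply/eqP; rewrite eq_le measure_ge0 andbT.
  apply: (@le_trans _ _ (m (~` orth J one))).
    by apply: le_measure; rewrite ?inE//; exact: measurableI.
  by rewrite probability_setC// m1 subee.
have nu1 : nu (orth J one) = 1%E by rewrite nuQ.
apply: agree_on_rat => v; set u := rat_pt R v.
have [u0|] := pselect (forall p, (p < d)%N -> J p -> 0 <= coord u p).
  pose u' : pt R d := [tuple clamp (coord u i) | i < d].
  have uE p : (p < d)%N -> coord u' p = clamp (coord u p).
    by move=> pd; rewrite (coord_mktuple (fun i => clamp (coord u i))).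
  have cu' : cube u' by move=> p pd; rewrite uE// clamp_itv.
  have E : orth J u `&` orth J one = orth J u'.
    have cl p : (p < d)%N -> J p -> clamp (coord u p) = Num.min (coord u p) 1.
      by move=> pd Jp; rewrite /clamp max_r// le_min ler01 u0.
    apply/seteqP; split=> x /=.
      move=> [xu x1] p pd Jp; rewrite uE// cl// le_min xu//=.
      by have := x1 p pd Jp; rewrite (coord_mktuple (fun=> 1)).
    move=> xu; split=> p pd Jp; have := xu p pd Jp; rewrite uE// cl// le_min => /andP[//].
    by rewrite (coord_mktuple (fun=> 1)).
  by rewrite (restr nu)// (restr Q)// E nuQ.
move=> /existsNP[p /not_implyP[pd /not_implyP[Jp /negP]]]; rewrite -ltNge => up.
(* A corner in the cube whose orthant contains almost all of [orth J u] and is null. *)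
pose z : pt R d := [tuple if val i == p then 0 else 1 | i < d].
have zE q : (q < d)%N -> coord z q = if q == p then 0 else 1.
  by move=> qd; rewrite (coord_mktuple (fun i => if i == p then 0 else 1)).
have cz : cube z.
  by move=> q qd; rewrite zE//; case: ifP; rewrite ?lexx ?ler01.
have Qz : Q (orth J z) = 0%E.
  have Q0 : Q [set x | coord x p <= 0] = 0%E by rewrite Qmarg// lexx ler01.
  apply/eqP; rewrite eq_le measure_ge0 andbT -[leRHS]Q0.
  apply: le_measure; rewrite ?inE//.
    exact: (measurable_coord_in p (measurable_le 0)).
  by move=> x /(_ p pd Jp); rewrite zE// eqxx.
have null (m : probability (pt R d) R) : m (orth J one) = 1%E ->
    m (orth J z) = 0%E -> m (orth J u) = 0%E.
  move=> m1 mz; rewrite restr//; apply/eqP; rewrite eq_le measure_ge0 andbT -mz.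
  apply: le_measure; rewrite ?inE//; first exact: measurableI.
  move=> x [xu x1] q qd Jq; rewrite zE//; case: eqP => [->|_].
    by rewrite (le_trans (xu p pd Jp))// ltW.
  by have := x1 q qd Jq; rewrite (coord_mktuple (fun=> 1)).
by rewrite !null// nuQ.
Qed.

Lemma rcd_agree (mu : probability (pt R d) R) L kappa :
  agree_on all_coords mu Q -> rcd mu L kappa -> rcd Q L kappa.
Proof.
move=> muQ [kL [mk kint]]; split=> //; split=> // A E mA mE.
have mA' : measurable A by case: mA.
rewrite -muQ; last by apply: L_measurableT; exact: measurableI.
rewrite kint//; apply: eq_measure_integral => B mB _.
by apply: muQ; exact: L_measurableT.
Qed.

(** [psi] may select any solution with any kernels. A step uses blocks of both preceding lengths,
    hence the strong induction. *)
Lemma pvc_unique mu nu k i : agree_on all_coords mu Q -> PVC_family mu nu ->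
  (i + k < d)%N -> agree_on (blk i k) (nu i k) Q.
Proof.
move=> muQ pvc; elim/ltn_ind: k i => k IH i ikd.
apply: agree_cube => u cu; have := pvc i k ikd; case: k => [|[|k]] in IH ikd *.
- rewrite addn0 in ikd; have [_ Qmarg] := Qcop.
  have -> : orth (blk i 0) u = [set x | coord x i <= coord u i].
    apply/seteqP; split=> x /=; first by apply=> //; rewrite /blk; lia.
    by move=> H p pd Hp; have -> : p = i by move: Hp; rewrite /blk; lia.
  by move=> ->; rewrite ?Qmarg//; exact: cu.
- by move=> ->//; rewrite muQ//; apply: L_measurableT; exact: measurable_orth.
move=> [k1 [k2 [k3 [r1 [r2 [r3 ->]]]]]]//.
apply: pvc_step r1 r2 (rcd_agree muQ r3) => //; apply: IH; lia.
Qed.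

(** A solution must exist for [epsilon] to return one. *)
Lemma pvc_self : PVC_family Q (fun _ _ => Q).
Proof.
move=> i [|[|k]] ikd.
- by rewrite addn0 in ikd; case: Qcop => _; exact.
- by [].
have ld : (i.+1 < d)%N by lia.
have [kappa r] : exists kappa, rcd Q (blk i.+1 k) kappa.
  by apply: (ex_rcd_mixture ld); rewrite /blk; lia.
by exists kappa, kappa, kappa; do 3 split=> //; move=> u cu; rewrite (pvc_step _ ikd _ _ _ r r r).
Qed.

Definition mixture_copula (u : pt R d) : R := fine (Q (orth all_coords u)).

Lemma mixture_copulaE u : (mixture_copula u)%:E = Q (orth all_coords u).
Proof. by rewrite fineK// fin_num_measure//; exact: measurable_orth. Qed.

Lemma represents_mixture : represents Q mixture_copula.
Proof. by split=> // u _; exact: mixture_copulaE. Qed.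

Lemma in_Cc_mixture : in_Cc mixture_copula.
Proof.
exists Q; split; first exact: represents_mixture.
move=> L j L0 _ jL kappa r; set K := (fun p => _) in r.
have [l lL] : exists l : 'I_d, l \in L by apply/set0Pn; rewrite -card_gt0.
have Kl : K l by exists l.
have nKj : ~ K j by move=> [i iL /val_inj ij]; rewrite -ij iL in jL.
have [//|N [[mN _] N0 HN]] :=
  @rcd_mixture all_coords K Q kappa l (ltn_ord l) Kl (fun _ _ _ => I) _ r.
exists N; split=> // x; apply: contra_notP => /HN[s [ws _ kP]].
change (continuous (cdf1 kappa j x)).
rewrite (_ : cdf1 kappa j x = Fs s j); last first.
  by apply/funext => t; rewrite (cdf1_mixture _ (ltn_ord j) ws _ kP).
move=> t; apply: (@continuous_comp _ _ _ (fun t => (t - a s j) / w s) (@clamp R)).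
  apply: cvgMl; apply: cvgB; [exact: cvg_id|exact: cvg_cst].
exact: continuous_clamp.
Qed.

(** By [pvc_self] the selected function is a genuine solution, and [pvc_unique] identifies it on the
    cube, outside which [is_PVC] leaves it arbitrary. *)
Lemma psi_mixture u : (0 < d)%N -> cube u -> psi mixture_copula u = mixture_copula u.
Proof.
move=> d0 cu; set C := mixture_copula.
have blkT (v : pt R d) : orth (blk 0 d.-1) v = orth all_coords v.
  apply/seteqP; split=> x H p pd _; apply: H => //; rewrite /blk; lia.
have Cself : is_PVC C C.
  exists Q, (fun _ _ => Q); split; first exact: represents_mixture.
  by split; [exact: pvc_self|move=> v cv; rewrite blkT mixture_copulaE].
have [mu [nu [[_ muC] [pvc CE]]]] : is_PVC C (psi C).
  by apply: (@epsilon_spec _ (inhabits C) (fun P => is_PVC C P)); exists C.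
have muQ : agree_on all_coords mu Q.
  by apply: agree_cube => v cv; rewrite -muC// mixture_copulaE.
apply: EFin_inj; rewrite CE// mixture_copulaE -blkT.
apply: (pvc_unique muQ pvc); first by lia.
exact: L_measurable_orth.
Qed.

End mixture_of_boxes.

(** * Cumulative weights along an injective key *)

Section ordered_weights.
Context (R : realType) (S : finType) (w : S -> R) (key : S -> nat) (K : nat).
Hypotheses (w0 : forall s, 0 <= w s) (w1 : \sum_s w s = 1).
Hypotheses (key_inj : injective key) (keyK : forall s, (key s < K)%N).

Lemma le_sum_sub (A B : pred S) : (forall s, A s -> B s) ->
  \sum_(s | A s) w s <= \sum_(s | B s) w s.
Proof.
move=> AB; rewrite big_mkcond [leRHS]big_mkcond; apply: ler_sum => s _.
by case: ifP => [/AB ->//|_]; case: ifP.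
Qed.

Definition cumul k := \sum_(s | (key s < k)%N) w s.

Lemma cumulS s : cumul (key s).+1 = cumul (key s) + w s.
Proof.
rewrite /cumul (bigD1 s)//= addrC; congr (_ + _); apply: eq_bigl => t.
by rewrite ltnS ltn_neqAle andbC (inj_eq key_inj).
Qed.

Lemma le_cumul k l : (k <= l)%N -> cumul k <= cumul l.
Proof. by move=> kl; apply: le_sum_sub => s /leq_trans; apply. Qed.

Lemma sum_cumul (g : R -> R) :
  \sum_s (g (cumul (key s) + w s) - g (cumul (key s))) = g 1 - g 0.
Proof.
rewrite (partition_big (fun s => Ordinal (keyK s)) xpredT)//=.
transitivity (\sum_(0 <= k < K) (g (cumul k.+1) - g (cumul k))); last first.
  rewrite telescope_sumr//; congr (g _ - g _).
    by rewrite -w1; apply: eq_bigl => s; rewrite keyK.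
  by rewrite /cumul big_pred0.
rewrite big_mkord; apply: eq_bigr => k _.
have [[s sk]|nk] := pselect (exists s, key s = k).
  rewrite (big_pred1 s) -?sk ?cumulS// => t.
  by rewrite /= -val_eqE/= -sk (inj_eq key_inj).
rewrite big_pred0; last first.
  by move=> s; apply/negP => /eqP/(congr1 val)/= sk; apply: nk; exists s.
rewrite (_ : cumul k.+1 = cumul k) ?subrr//; apply: eq_bigl => s.
rewrite ltnS leq_eqVlt; case: eqP => // sk.
by exfalso; apply: nk; exists s.
Qed.

End ordered_weights.

Section finite_valued.
Context dT (T : measurableType dT) (R : realType) (mu : probability T R).
Context (S : finType) (f : T -> S).
Hypothesis mf : forall s, measurable [set x | f x = s].

Lemma measure_fibers A : measurable A ->
  mu A = (\sum_s mu (A `&` [set x | f x = s]))%E.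
Proof.
move=> mA.
have {1}-> : A = \bigcup_(s in [set` index_enum S]) (A `&` [set x | f x = s]).
  apply/seteqP; split=> x; last by move=> [s _ []].
  by move=> Ax; exists (f x) => //=; rewrite mem_index_enum.
rewrite measure_fin_bigcup//.
- by rewrite -fsbig_seq//; exact: index_enum_uniq.
- apply/trivIsetP => s t _ _ st; apply/seteqP; split=> // x /= [[_ ->] [_ /eqP]].
  by rewrite (negbTE st).
- by move=> s _; exact: measurableI.
Qed.

Lemma measure_fiber_sum (A : pred S) :
  mu [set x | A (f x)] = (\sum_(s | A s) mu [set x | f x = s])%E.
Proof.
rewrite measure_fibers; last first.
  rewrite (_ : [set _ | _] = \bigcup_s (if A s then [set x | f x = s] else set0)).
    by apply: countable_bigcupT_measurable => // s; case: ifP.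
  by apply/seteqP; split=> x /= => [Ax|[s _]]; [exists (f x); rewrite ?Ax|case: ifP => //= As ->].
rewrite [RHS]big_mkcond; apply: eq_bigr => s _; case: ifPn => As.
  by congr (mu _); apply/seteqP; split=> x /= => [[]//|fx]; rewrite fx.
rewrite (_ : _ `&` _ = set0) ?measure0//.
by apply/seteqP; split=> // x /= [+ fx]; rewrite fx (negbTE As).
Qed.

End finite_valued.

(** * The grid, its weights and the approximating copula *)

Section grid.
Context (R : realType) (d n : nat) (mu : probability (pt R d) R).
Hypothesis mucop : is_copula_measure mu.

Local Notation N := (n.+1%:R : R).

(** Cells are closed on the right, matching orthants and slabs. A failing [find] returns [n], so the
    last cell also takes everything above 1, and the first everything below 0. *)
Definition cidx (t : R) : nat := find (fun j : nat => t <= j.+1%:R / N) (iota 0 n).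

Lemma cidx_max t : (cidx t <= n)%N.
Proof. by rewrite -[X in (_ <= X)%N](size_iota 0 n) find_size. Qed.

Lemma cidx_le t k : (k < n)%N -> (cidx t <= k)%N = (t <= k.+1%:R / N).
Proof.
move=> kn; rewrite -ltnS -has_take_leq ?size_iota// take_iota (minn_idPl kn).
apply/hasP/idP => [[j]|tk]; last first.
  by exists k; [rewrite mem_iota add0n ltnSn|exact: tk].
rewrite mem_iota add0n => jk /le_trans; apply.
by rewrite ler_pM2r ?invr_gt0// ler_nat.
Qed.

Lemma cidx_homo t t' : t <= t' -> (cidx t <= cidx t')%N.
Proof.
move=> tt; have [kn|nk] := ltnP (cidx t') n; last exact: leq_trans (cidx_max t) nk.
by rewrite cidx_le// (le_trans tt)// -cidx_le.
Qed.

Lemma measurable_cidx_le k : measurable [set t | (cidx t <= k)%N].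
Proof.
have [kn|nk] := ltnP k n.
  rewrite (_ : [set _ | _] = [set t | t <= k.+1%:R / N]); first exact: measurable_le.
  by apply/seteqP; split=> t /=; rewrite cidx_le.
rewrite (_ : [set _ | _] = setT)//.
by apply/seteqP; split=> // t _ /=; exact: leq_trans (cidx_max t) nk.
Qed.

Lemma measurable_cidx k : measurable [set t | cidx t = k].
Proof.
have mle := measurable_cidx_le.
case: k => [|k].
  rewrite (_ : [set _ | _] = [set t | (cidx t <= 0)%N])//.
  by apply/seteqP; split=> t /=; rewrite leqn0; [move=> ->|move/eqP].
rewrite (_ : [set _ | _] = [set t | (cidx t <= k.+1)%N] `\` [set t | (cidx t <= k)%N]).
  exact: measurableD.
apply/seteqP; split=> t /=; first by move=> ->; split; lia.
by move=> []; lia.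
Qed.

Definition cell (x : pt R d) : {ffun 'I_d -> 'I_n.+1} :=
  [ffun p : 'I_d => inord (cidx (coord x p))].

Local Notation S := {ffun 'I_d -> 'I_n.+1}.

Definition sidx (s : S) (p : nat) : nat := oapp (fun i : 'I_d => val (s i)) 0%N (insub p).

Lemma sidxE s (p : 'I_d) : sidx s p = s p.
Proof. by rewrite /sidx valK. Qed.

Lemma sidx_le s p : (sidx s p <= n)%N.
Proof. by rewrite /sidx; case: insub => //= i; rewrite -ltnS. Qed.

Lemma sidx_cell x p : (p < d)%N -> sidx (cell x) p = cidx (coord x p).
Proof.
move=> pd; rewrite (sidxE _ (Ordinal pd)) ffunE inordK// ltnS; exact: cidx_max.
Qed.

Lemma measurable_cell s : measurable [set x | cell x = s].
Proof.
rewrite (_ : [set _ | _] = cbox (fun p => [set t | cidx t = sidx s p])).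
  by apply: measurable_box => p _; exact: measurable_cidx.
apply/seteqP; split=> x /=; first by move=> <- p pd /=; rewrite sidx_cell.
move=> H; apply/ffunP => p; apply/val_inj.
by rewrite -[LHS]sidxE -[RHS]sidxE sidx_cell//; exact: H.
Qed.

Definition wt (s : S) : R := fine (mu [set x | cell x = s]).

Lemma wtE s : (wt s)%:E = mu [set x | cell x = s].
Proof. by rewrite fineK// fin_num_measure//; exact: measurable_cell. Qed.

Lemma wt_ge0 s : 0 <= wt s.
Proof. by rewrite -lee_fin wtE. Qed.

Lemma sum_wt (A : pred S) : (\sum_(s | A s) wt s)%:E = mu [set x | A (cell x)].
Proof.
rewrite (measure_fiber_sum _ measurable_cell) -sumEFin.
by apply: eq_bigr => s _; rewrite wtE.
Qed.

Lemma sum_wt1 : \sum_s wt s = 1.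
Proof.
apply: EFin_inj; rewrite sum_wt -(@probability_setT _ _ _ mu); congr (mu _).
by apply/seteqP; split.
Qed.

Lemma sum_wt_lt p k : (p < d)%N -> (k <= n.+1)%N ->
  \sum_(s | (sidx s p < k)%N) wt s = k%:R / N.
Proof.
move=> pd kn; apply: EFin_inj; rewrite sum_wt.
rewrite (_ : [set _ | _] = [set x | (cidx (coord x p) < k)%N]); last first.
  by apply/seteqP; split=> x /=; rewrite sidx_cell.
case: k kn => [_|k].
  by rewrite mul0r (_ : [set _ | _] = set0) ?measure0//; apply/seteqP; split.
rewrite ltnS leq_eqVlt => /orP[/eqP->|kn].
  rewrite divff ?pnatr_eq0// (_ : [set _ | _] = setT) ?probability_setT//.
  by apply/seteqP; split=> // x _ /=; rewrite ltnS cidx_max.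
have [_ marg] := mucop; rewrite -(marg p pd).
  by congr (mu _); apply/seteqP; split=> x /=; rewrite ltnS cidx_le.
by rewrite divr_ge0//= ler_pdivrMr// mul1r ler_nat ltnW.
Qed.

(** The mass of one layer of cells, the source of the error bound. *)
Lemma sum_wt_eq p k : (p < d)%N -> (k <= n)%N ->
  \sum_(s | sidx s p == k) wt s = N^-1.
Proof.
move=> pd kn.
have := @sum_wt_lt p k.+1 pd kn; rewrite (bigID (fun s => sidx s p == k))/=.
rewrite (eq_bigl (fun s => sidx s p == k)); last by move=> s /=; lia.
rewrite [X in _ + X](eq_bigl (fun s => (sidx s p < k)%N)); last by move=> s /=; lia.
rewrite sum_wt_lt//; last by lia.
by rewrite -[X in _ = X / _]natr1 mulrDl mul1r addrC => /addrI.
Qed.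

(** Lexicographic order on cell index and rank, written in base [#|S|]. *)
Definition cell_key p (s : S) : nat := (sidx s p * #|S| + enum_rank s)%N.

Lemma cell_key_inj p : injective (cell_key p).
Proof.
move=> s t /(congr1 (fun m => (m %% #|S|)%N)).
rewrite /cell_key !modnMDl !modn_small ?ltn_ord// => /val_inj; exact: enum_rank_inj.
Qed.

Lemma cell_key_lt p s : (cell_key p s < n.+1 * #|S|)%N.
Proof.
have r := ltn_ord (enum_rank s); have := sidx_le s p.
rewrite /cell_key mulSn => h.
by rewrite addnC -addSn leq_add// leq_mul2r h orbT.
Qed.

Lemma cell_key_sidx p s t : (sidx s p < sidx t p)%N -> (cell_key p s < cell_key p t)%N.
Proof.
move=> st; have r := ltn_ord (enum_rank s); rewrite /cell_key.
apply: leq_trans (leq_addr _ _).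
have : ((sidx s p).+1 * #|S| <= sidx t p * #|S|)%N by rewrite leq_mul2r st orbT.
by rewrite mulSn; apply: leq_trans; rewrite addnC -addSn leq_add2r.
Qed.

(* The components sharing a cell index in coordinate [p] split that cell into
   adjacent intervals of lengths [wt s], ordered by the rank of [s]. *)
Definition left_end (s : S) p := cumul wt (cell_key p) (cell_key p s).

(** Components with a smaller index in coordinate [p] all come earlier, and their total mass is the
    left end of the cell. *)
Lemma left_end_ge s p : (p < d)%N -> (sidx s p)%:R / N <= left_end s p.
Proof.
move=> pd; rewrite -(sum_wt_lt pd); last by have := sidx_le s p; lia.
by apply: (le_sum_sub wt_ge0) => t; exact: cell_key_sidx.
Qed.

Lemma right_end_le s p : (p < d)%N -> left_end s p + wt s <= (sidx s p).+1%:R / N.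
Proof.
move=> pd; rewrite -(sum_wt_lt pd); last by have := sidx_le s p; lia.
rewrite /left_end -cumulS; last exact: cell_key_inj.
apply: (le_sum_sub wt_ge0) => t; rewrite !ltnS => ts.
by rewrite leqNgt; apply/negP => /cell_key_sidx; rewrite ltnNge ts.
Qed.

Lemma left_end_disj s t p : s != t -> (p < d)%N ->
  left_end s p + wt s <= left_end t p \/ left_end t p + wt t <= left_end s p.
Proof.
move=> st _; rewrite /left_end -!cumulS; try exact: cell_key_inj.
have [kst|ts] := ltnP (cell_key p s) (cell_key p t).
  by left; apply: le_cumul => //; exact: wt_ge0.
right; apply: le_cumul; first exact: wt_ge0.
rewrite ltn_neqAle ts andbT.
by rewrite (inj_eq (@cell_key_inj p)) eq_sym.
Qed.

(** The weight cancels the density: what remains is the length of the part of the interval below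
    [t], in the form that [sum_cumul] telescopes. *)
Lemma wt_clamp s p t : 0 < wt s -> wt s * clamp ((t - left_end s p) / wt s) =
  Num.min t (left_end s p + wt s) - Num.min t (left_end s p).
Proof.
move=> ws; set b := left_end s p; have wN : wt s != 0 by rewrite gt_eqF.
have [tb|bt] := leP t b.
  rewrite clamp_le0 ?mulr0; last by rewrite pmulr_lle0 ?invr_gt0// subr_le0.
  by rewrite !min_l ?subrr// (le_trans tb)// lerDl wt_ge0.
have [tw|wt'] := leP t (b + wt s).
  rewrite clamp_id; first by rewrite mulrC divfK.
  rewrite divr_ge0 ?subr_ge0 ?(ltW bt) ?wt_ge0//=.
  by rewrite ler_pdivrMr// mul1r lerBlDl.
rewrite clamp_ge1; last by rewrite ler_pdivlMr// mul1r lerBrDl ltW.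
by rewrite mulr1 addrC addKr.
Qed.

Lemma ex_pvc_approximation : exists C' : pt R d -> R,
  [/\ in_Cc C', forall u, (0 < d)%N -> cube u -> psi C' u = C' u &
      forall u, cube u -> `|fine (mu (orth all_coords u)) - C' u| <= d%:R / N].
Proof.
have [P Pbox] : exists P : S -> probability (pt R d) R,
    forall s, box_rule (fun p => unif (left_end s p) (wt s)) (P s).
  have /choice[P HP] : forall s : S, exists P : probability (pt R d) R,
      box_rule (fun p => unif (left_end s p) (wt s)) P.
    by move=> s; exact: ex_box_rule.
  by exists P.
have [Q [QE Qint]] := ex_mixture P wt_ge0 sum_wt1.
have P1 s (B : nat -> set R) : 0 < wt s -> (forall p, measurable (B p)) ->
    (forall p, (p < d)%N -> `]left_end s p, left_end s p + wt s]%classic `<=` B p) ->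
    P s (cbox B) = 1%E.
  move=> ws mB sB; rewrite (Pbox s)// big1// => p _.
  apply/eqP; rewrite eq_le probability_le1//=.
  rewrite -(unif_support (left_end s p) ws); apply: le_measure; rewrite ?inE//.
  exact: sB.
have Qcop : is_copula_measure Q.
  split=> [|p pd t t01].
    rewrite QE (eq_bigr (fun s => (wt s)%:E)) ?sumEFin ?sum_wt1// => s _.
    have := wt_ge0 s; rewrite le_eqVlt => /orP[/eqP <-|ws]; first by rewrite mul0e.
    rewrite cube_box P1 ?mule1// => p pd x /=; rewrite !in_itv/= => /andP[x1 x2].
    rewrite (le_trans _ (ltW x1)) ?(le_trans _ (left_end_ge s pd)) ?divr_ge0//=.
    rewrite (le_trans x2)// (le_trans (right_end_le s pd))//.
    by rewrite ler_pdivrMr// mul1r ler_nat ltnS sidx_le.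
  rewrite QE (eq_bigr (fun s => (Num.min t (left_end s p + wt s) -
      Num.min t (left_end s p))%:E)); last first.
    move=> s _; rewrite (box_rule_coord (Pbox s) pd (measurable_le t)).
    have := wt_ge0 s; rewrite le_eqVlt => /orP[/eqP w0|ws].
      by rewrite -w0 mul0e addr0 subrr.
    by rewrite unif_cdf// -EFinM wt_clamp.
  rewrite sumEFin /left_end.
  rewrite (sum_cumul sum_wt1 (@cell_key_inj p) (@cell_key_lt p) (Num.min t)).
  by case/andP: t01 => t0 t1; rewrite min_l// min_r// subr0.
exists (mixture_copula Q); split.
- exact: in_Cc_mixture wt_ge0 left_end_disj Pbox QE Qcop.
- by move=> u; exact: (psi_mixture wt_ge0 sum_wt1 left_end_disj Pbox QE Qint Qcop).
move=> u cu; set O := orth all_coords u.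
have mO : measurable O by exact: measurable_orth.
pose m s := fine (mu (O `&` [set x | cell x = s])).
pose r s := fine (P s O).
have mE s : (m s)%:E = mu (O `&` [set x | cell x = s]).
  by rewrite fineK// fin_num_measure//; apply: measurableI => //; exact: measurable_cell.
have rE s : (r s)%:E = P s O by rewrite fineK// fin_num_measure.
have -> : fine (mu O) = \sum_s m s.
  apply: EFin_inj; rewrite fineK ?fin_num_measure// (measure_fibers _ measurable_cell mO).
  by rewrite -sumEFin; apply: eq_bigr => s _; rewrite mE.
have -> : mixture_copula Q u = \sum_s wt s * r s.
  apply: EFin_inj; rewrite mixture_copulaE QE -sumEFin.
  by apply: eq_bigr => s _; rewrite EFinM rE.
have m0 s : 0 <= m s by rewrite -lee_fin mE.
have mw s : m s <= wt s.
  rewrite -lee_fin mE wtE; apply: le_measure; rewrite ?inE//.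
    by apply: measurableI => //; exact: measurable_cell.
  exact: measurable_cell.
have r0 s : 0 <= r s by rewrite -lee_fin rE.
have r1 s : r s <= 1 by rewrite -lee_fin rE probability_le1.
(* A cell whose index differs from that of [u] in every coordinate contributes equally to both
   copulas; any other cell errs by at most its weight and lies in one of [d] layers. *)
have key s : `|m s - wt s * r s| <=
    \sum_(p < d) (if sidx s p == cidx (coord u p) then wt s else 0).
  have [/existsP[p /eqP pc]|/existsPn nc] :=
    boolP [exists p : 'I_d, sidx s p == cidx (coord u p)].
    rewrite (bigD1 p)//= pc eqxx; apply: ler_wpDr.
      by apply: sumr_ge0 => q _; case: ifP => // _; exact: wt_ge0.
    rewrite ler_norml; apply/andP; split.
      by rewrite lerBrDl (le_trans _ (m0 s))// subr_le0 ler_piMr// wt_ge0.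
    by rewrite lerBlDr (le_trans (mw s))// lerDl mulr_ge0// wt_ge0.
  suff -> : m s = wt s * r s.
    by rewrite subrr normr0 sumr_ge0// => p _; case: ifP => // _; exact: wt_ge0.
  have := wt_ge0 s; rewrite le_eqVlt => /orP[/eqP ws|ws].
    by rewrite -ws mul0r; apply/eqP; rewrite eq_le m0 andbT ws mw.
  (* If some index exceeds that of [u], both masses vanish; otherwise all indices are smaller and
     both are full. *)
  have [/existsP[p pc]|/existsPn nlt] :=
    boolP [exists p : 'I_d, (cidx (coord u p) < sidx s p)%N].
    have pd := ltn_ord p.
    have -> : m s = 0.
      apply: EFin_inj; rewrite mE (_ : _ `&` _ = set0) ?measure0//.
      apply/seteqP; split=> // x /= [/(_ p pd I)/cidx_homo xu xs].
      by move: pc; rewrite -xs sidx_cell// ltnNge xu.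
    have -> : r s = 0.
      apply: EFin_inj; rewrite rE; apply/eqP; rewrite eq_le measure_ge0 andbT.
      apply: (@le_trans _ _ (P s [set x | coord x p <= coord u p])).
        apply: le_measure; rewrite ?inE//.
          exact: (measurable_coord_in p (measurable_le (coord u p))).
        by move=> x; apply.
      rewrite (box_rule_coord (Pbox s) pd (measurable_le _)) unif_cdf// clamp_le0//.
      rewrite pmulr_lle0 ?invr_gt0// subr_le0 (le_trans _ (left_end_ge s pd))//.
      have cn : (cidx (coord u p) < n)%N by apply: leq_trans pc (sidx_le s p).
      have := leqnn (cidx (coord u p)); rewrite cidx_le// => /le_trans; apply.
      by rewrite ler_pM2r ?invr_gt0// ler_nat.
    by rewrite mulr0.
  have lt p : (p < d)%N -> (sidx s p < cidx (coord u p))%N.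
    by move=> pd; have := nc (Ordinal pd); have := nlt (Ordinal pd); rewrite /=; lia.
  have -> : m s = wt s.
    apply: EFin_inj; rewrite mE wtE; congr (mu _); apply/setIidPr => x /= xs p pd _.
    rewrite leNgt; apply/negP => /ltW/cidx_homo; rewrite leqNgt.
    by rewrite -(sidx_cell x pd) xs lt.
  have -> : r s = 1.
    apply: EFin_inj; rewrite rE /O orth_box P1//; first by move=> p; case: ifP.
    move=> p pd x /=; rewrite in_itv/= => /andP[_ xr].
    case: asboolP => // _; rewrite /= in_itv/= (le_trans xr)//.
    rewrite (le_trans (right_end_le s pd))//.
    have lp := lt p pd; have sn : (sidx s p < n)%N by apply: leq_trans lp (cidx_max _).
    by rewrite leNgt; apply/negP => /ltW; rewrite -cidx_le// leqNgt lp.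
  by rewrite mulr1.
rewrite -sumrB (le_trans (ler_norm_sum _ _ _))//.
rewrite (le_trans (ler_sum _ (fun s _ => key s)))// exchange_big/=.
rewrite (eq_bigr (fun=> N^-1)).
  by rewrite sumr_const card_ord -[leLHS]mulr_natl.
by move=> p _; rewrite -big_mkcond sum_wt_eq// cidx_max.
Qed.

End grid.

(** * Discontinuity *)

Theorem theorem7p7 (R : realType) (d : nat) (C : pt R d -> R) :
  (3 <= d)%N ->
  in_Cc C ->
  dinf C (psi C) != 0 ->
  ~ (forall e : R, 0 < e -> exists2 delta : R, 0 < delta &
       forall C' : pt R d -> R, in_Cc C' ->
         dinf C C' < delta -> dinf (psi C) (psi C') < e).
Proof.
move=> d3 [mu [[mucop muC] _]] D0 H.
pose gap (F G : pt R d -> R) := [set `|F u - G u| | u in @cube R d].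
have gap_ub (F G : pt R d -> R) c : (forall u, cube u -> `|F u - G u| <= c) ->
    has_sup (gap F G) /\ dinf F G <= c.
  move=> Fc; have ne : gap F G !=set0.
    exists `|F [tuple 0 | i < d] - G [tuple 0 | i < d]|; eexists; last reflexivity.
    by move=> p pd; rewrite (coord_mktuple (fun=> 0))// lexx ler01.
  have ub : ubound (gap F G) c by move=> _ [u cu <-]; exact: Fc.
  by split; [split=> //; exists c|exact: ge_sup].
have le_dinf (F G : pt R d -> R) u : has_sup (gap F G) -> cube u -> `|F u - G u| <= dinf F G.
  by move=> [_ hs] cu; apply: (ub_le_sup hs); exists u.
set D := dinf C (psi C) in D0.
(* [sup] is 0 on unbounded sets, so [D0] excludes them and no existence
   theorem for the partial vine copula of [C] is needed. *)
have hsD : has_sup (gap C (psi C)).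
  by apply: contrapT => ns; move: D0; rewrite /D /dinf sup_out ?eqxx.
have Dgt0 : 0 < D.
  rewrite lt_neqAle eq_sym D0/=; have [[_ [u cu _]] _] := hsD.
  exact: le_trans (le_dinf _ _ u hsD cu).
(* With [C'] within D/2 of [C], and [psi C'] within D/2 of [psi C], both strictly, the triangle
   inequality through [C'], equal to [psi C'] on the cube, gives D < D. *)
have [|delta delta0 Hd] := H (D / 2); first by rewrite divr_gt0.
pose m := Num.min delta (D / 2).
have m0 : 0 < m by rewrite lt_min delta0 divr_gt0.
pose n := Num.truncn (d%:R / m : R).
have dn : d%:R / n.+1%:R < m.
  by rewrite ltr_pdivrMr// mulrC -ltr_pdivrMr// truncnS_gt.
have [C' [C'c psiC' CC']] := @ex_pvc_approximation R d n mu mucop.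
have CE u : cube u -> C u = fine (mu (orth all_coords u)) by move=> cu; rewrite -muC.
have [|hs1 le1] := gap_ub C C' (d%:R / n.+1%:R).
  by move=> u cu; rewrite CE//; exact: CC'.
have lt2 : dinf (psi C) (psi C') < D / 2.
  by apply: Hd => //; apply: le_lt_trans le1 (lt_le_trans dn _); rewrite ge_min lexx.
have psiE u : cube u -> psi C' u = C' u by move=> cu; rewrite psiC'//; lia.
(* [le_dinf] applies only to a bounded set; the detour through [C] bounds this one. *)
have [|hs2 _] := gap_ub (psi C) (psi C') (D + d%:R / n.+1%:R).
  move=> u cu; rewrite psiE// (le_trans (ler_distD (C u) _ _))// lerD//.
    by rewrite distrC; exact: le_dinf.
  by rewrite CE//; exact: CC'.
have [|_] := gap_ub C (psi C) (d%:R / n.+1%:R + dinf (psi C) (psi C')).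
  move=> u cu; rewrite (le_trans (ler_distD (C' u) _ _))// lerD//.
    by rewrite CE//; exact: CC'.
  by rewrite -psiE// distrC; exact: le_dinf.
rewrite -/D => DD.
have mD : m <= D / 2 by rewrite ge_min lexx orbT.
have := le_lt_trans DD (ltrD (lt_le_trans dn mD) lt2).
by rewrite -splitr ltxx.
Qed.
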